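(* Let $d\geq 2$, let $H \leq \mathrm{Aut}(\mathcal{T}_d)$ be a regular branch group, branching over a congruence subgroup, and let $G$ be the topological closure of $H$ in $\mathrm{Aut}(\mathcal{T}_d)$. Then the inclusion of $\mathrm{AAut}_H(\mathcal{T}_d)$ in $\mathrm{AAut}_G(\mathcal{T}_d)$ induces an isomorphism of topological groups between the Schlichting completion $\mathrm{AAut}_H(\mathcal{T}_d) /\!\!/ H$ and $\mathrm{AAut}_G(\mathcal{T}_d)$.
   Context: $\mathcal{T}_d$ is the rooted $d$-regular tree with vertex set $X^*$ (finite words over an ordered alphabet $X$ with $|X|=d$), $\mathrm{Aut}(\mathcal{T}_d)$ its group of automorphisms with its profinite topology (pointwise level stabilizers form a basis of neighbourhoods of $1$). For $g\in\mathrm{Aut}(\mathcal{T}_d)$ and a vertex $v$, the section $g_v$ is defined by $g(vw)=g(v)g_v(w)$ for all $w\in X^*$. A subgroup $H\leq\mathrm{Aut}(\mathcal{T}_d)$ is self-similar if every section of every element of $H$ is in $H$. For $H$ self-similar, let $\psi:H\to H\wr\mathrm{Sym}(d)$ be the injective homomorphism given by the level-one sections and the action on level one. $H$ is regular branch over its finite index subgroup $K$ if $\psi(K)$ contains $K\times\cdots\times K$ ($d$ factors) as a subgroup of finite index; $H$ is a regular branch group if it is self-similar and regular branch over some such $K$. A finite index subgroup of $H$ is a congruence subgroup if it contains the pointwise stabilizer in $H$ of some level. Being regular branch passes to closures in $\mathrm{Aut}(\mathcal{T}_d)$. A finite subtree $T$ of $\mathcal{T}_d$ is a rooted complete subtree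 if it contains the root as a vertex of degree $d$ and every other vertex of $T$ which is not a leaf has degree $d+1$ in $T$. $\mathcal{T}_d\setminus T$ is regarded as the forest of subtrees hanging at the leaves of $T$, each naturally identified with $\mathcal{T}_d$. $\mathrm{AAut}(\mathcal{T}_d)$ is the group of homeomorphisms of $\partial_\infty\mathcal{T}_d$ induced by triples $(\psi,T,T')$ with $T,T'$ finite rooted complete subtrees with the same number of leaves and $\psi:\mathcal{T}_d\setminus T\to\mathcal{T}_d\setminus T'$ a forest isomorphism (mapping components bijectively onto components by tree isomorphisms). For $G$ self-similar, $\mathrm{AAut}_G(\mathcal{T}_d)$ is the subgroup of elements represented by a triple such that $\psi$ acts by an element of $G$ on each component; it contains $G$. When $G$ is a closed regular branch group, $\mathrm{AAut}_G(\mathcal{T}_d)$ is endowed with the group topology for which $G$, with its topology induced from $\mathrm{Aut}(\mathcal{T}_d)$, is a compact open subgroup. For a group $\Gamma$ and a commensurated subgroup $\Lambda$ (i.e. $\gamma\Lambda\gamma^{-1}\cap\Lambda$ has finite index in $\Lambda$ and in $\gamma\Lambda\gamma^{-1}$ for all $\gamma \in \Gamma$), the Schlichting completion $\Gamma/\!\!/\Lambda$ is the closure of the image of $\Gamma$ in $\mathrm{Sym}(\Gamma/\Lambda)$ (left action on cosets), with the topology of pointwise convergence. That an inclusion $\Gamma\subset G'$ into a topological group induces an isomorphism $\Gamma/\!\!/\Lambda\to G'$ means that there is an isomorphism of topological groups $\varphi:\Gamma/\!\!/\Lambda\to G'$ whose composition with the canonical map $\Gamma\to\Gamma/\!\!/\Lambda$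 is the inclusion. *)

(* Defs.v *)
From HB Require Import structures.
From mathcomp Require Import all_boot finmap.
From mathcomp Require Import all_classical.
From mathcomp Require Import topology.

Set Implicit Arguments.
Unset Strict Implicit.
Unset Printing Implicit Defensive.

Local Open Scope classical_set_scope.
Local Open Scope group_scope.

Definition subgroup (G : groupType) (A : set G) : Prop := group_closed [in A].

Definition ltranslate (G : groupType) (g : G) (A : set G) : set G :=
  [set g * a | a in A].

Definition lcosets (G : groupType) (A B : set G) : set (set G) :=
  [set ltranslate g B | g in A].

Definition finite_index_subgroup (G : groupType) (A B : set G) : Prop :=
  [/\ subgroup B, B `<=` A & finite_set (lcosets A B)].

(* The symmetric group of a type. Permutations compose as functions,
   (f * g) x = f (g x), unlike those of perm.v. *)

Record sym (T : Type) := Sym { sym_fun :> T -> T; symP : bijective sym_fun }.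

Section SymGroup.
Variable T : Type.
Implicit Types f g h : sym T.

Lemma symE f g : f =1 g -> f = g.
Proof.
case: f g => f pf [g pg] /= /funext fg; subst g; congr Sym.
exact: Prop_irrelevance.
Qed.

HB.instance Definition _ := gen_eqMixin (sym T).
HB.instance Definition _ := gen_choiceMixin (sym T).

Lemma sym_inv_ex f : exists g : T -> T, cancel f g /\ cancel g f.
Proof. by case: (symP f) => g fK gK; exists g. Qed.

Definition sym_inv_fun f : T -> T := projT1 (cid (sym_inv_ex f)).

Lemma sym_funK f : cancel f (sym_inv_fun f).
Proof. by rewrite /sym_inv_fun; case: cid => g []. Qed.

Lemma sym_invK f : cancel (sym_inv_fun f) f.
Proof. by rewrite /sym_inv_fun; case: cid => g []. Qed.

Definition sym_one := Sym (Bijective (fun=> erefl) (fun=> erefl) :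
  bijective (@id T)).
Definition sym_mul f g := Sym (bij_comp (symP f) (symP g)).
Definition sym_inv f := Sym (Bijective (sym_invK f) (sym_funK f)).

Lemma sym_mulA : associative sym_mul. Proof. by move=> *; exact: symE. Qed.
Lemma sym_1mul : left_id sym_one sym_mul.
Proof. by move=> *; exact: symE. Qed.
Lemma sym_mul1 : right_id sym_one sym_mul.
Proof. by move=> *; exact: symE. Qed.
Lemma sym_mulV : left_inverse sym_one sym_inv sym_mul.
Proof. by move=> f; apply: symE => x /=; rewrite sym_funK. Qed.
Lemma sym_mulgV : right_inverse sym_one sym_inv sym_mul.
Proof. by move=> f; apply: symE => x /=; rewrite sym_invK. Qed.

HB.instance Definition _ :=
  isGroup.Build (sym T) sym_mulA sym_1mul sym_mul1 sym_mulV sym_mulgV.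

Lemma symKV f : cancel f (f^-1)%g. Proof. exact: sym_funK. Qed.
Lemma symVK f : cancel (f^-1)%g f. Proof. exact: sym_invK. Qed.

Definition sym_ptws f : {ptws T -> discrete_topology {classic T}} := f.

(* topology of pointwise convergence, T being discrete *)
HB.instance Definition _ :=
  Topological.copy (sym T) (initial_topology sym_ptws).

End SymGroup.

(* The Schlichting completion of A with respect to B, for subgroups B <= A *)

Definition coset (G : groupType) (A B : set G) : Type :=
  set_type (lcosets A B).

(* when g belongs to the group A, this is the singleton of the permutation
   of A / B induced by g *)
Definition coset_action (G : groupType) (A B : set G) (g : G) :
    set (sym (coset A B)) :=
  [set s | forall C, \val (s C) = ltranslate g (\val C)].
Arguments coset_action {G} A B g.

Definition schlichting (G : groupType) (A B : set G) :
    set (sym (coset A B)) :=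
  closure (\bigcup_(g in A) coset_action A B g).
Arguments schlichting {G} A B.

(* The wreath product is the one of left actions: the sections of a product are
   (g h)_x = g_(h x) h_x, see psiM. *)

Definition wreath (G : groupType) (d : nat) : Type :=
  (('I_d -> G) * sym 'I_d)%type.

Section Wreath.
Variables (G : groupType) (d : nat).
Implicit Types u v : wreath G d.

HB.instance Definition _ := Choice.on (wreath G d).

Definition wreath_one : wreath G d := (fun=> 1, 1).
Definition wreath_mul u v : wreath G d :=
  (fun x => u.1 (v.2 x) * v.1 x, u.2 * v.2).
Definition wreath_inv u : wreath G d :=
  (fun x => (u.1 (u.2^-1 x))^-1, u.2^-1).

Lemma wreath_mulA : associative wreath_mul.
Proof.
by move=> u v w; congr pair; rewrite ?mulgA//; apply/funext => x /=; rewrite mulgA.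
Qed.
Lemma wreath_1mul : left_id wreath_one wreath_mul.
Proof.
by case=> u s; congr pair; rewrite /= ?mul1g//; apply/funext => x /=; rewrite mul1g.
Qed.
Lemma wreath_mul1 : right_id wreath_one wreath_mul.
Proof.
by case=> u s; congr pair; rewrite /= ?mulg1//; apply/funext => x /=; rewrite mulg1.
Qed.
Lemma wreath_mulV : left_inverse wreath_one wreath_inv wreath_mul.
Proof.
case=> u s; congr pair; rewrite /= ?mulVg//; apply/funext => x /=.
by rewrite sym_funK mulVg.
Qed.
Lemma wreath_mulgV : right_inverse wreath_one wreath_inv wreath_mul.
Proof.
by case=> u s; congr pair; rewrite /= ?mulgV//; apply/funext => x /=; rewrite mulgV.
Qed.

HB.instance Definition _ := isGroup.Build (wreath G d)
  wreath_mulA wreath_1mul wreath_mul1 wreath_mulV wreath_mulgV.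

End Wreath.

(* Vertices of the rooted d-regular tree are words; rcons v x is a child of v. *)

Definition word (d : nat) : Type := seq 'I_d.
HB.instance Definition _ d := Choice.on (word d).

Definition adj d (u v : word d) : bool :=
  [exists x, v == rcons u x] || [exists x, u == rcons v x].

Definition is_aut d (g : sym (word d)) : Prop :=
  g [::] = [::] /\ forall u v, adj (g u) (g v) = adj u v.

Record aut (d : nat) := Aut {
  aut_sym :> sym (word d);
  autP : `[< is_aut aut_sym >] }.

Section Aut.
Variable d : nat.

HB.instance Definition _ := [isSub of aut d for @aut_sym d].
HB.instance Definition _ := [Choice of aut d by <:].

Lemma is_aut_group : group_closed [pred g : sym (word d) | `[< is_aut g >]].
Proof.
split=> [|g h /asboolP[g0 ga] /asboolP[h0 ha]]; apply/asboolP; first by split.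
split=> [|u v].
  by change (g (h^-1 [::]) = [::]); rewrite -{1}h0 symKV.
by change (adj (g (h^-1 u)) (g (h^-1 v)) = adj u v); rewrite ga -ha !symVK.
Qed.

HB.instance Definition _ :=
  SubChoice_isSubGroup.Build (sym (word d)) _ (aut d) is_aut_group.

Implicit Types (g h : aut d) (u v w : word d) (x y : 'I_d).

Lemma autE g h : g =1 h -> g = h.
Proof. by move=> gh; apply/val_inj/symE. Qed.

Lemma aut_nil g : g [::] = [::].
Proof. by case: g => g /= /asboolP[]. Qed.

Lemma aut_adj g u v : adj (g u) (g v) = adj u v.
Proof. by case: g => g /= /asboolP[]. Qed.

Lemma autVK g : cancel (g^-1)%g g.
Proof. exact: symVK. Qed.

Lemma autKV g : cancel g (g^-1)%g.
Proof. exact: symKV. Qed.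

Lemma adj_rcons u x : adj u (rcons u x).
Proof. by apply/orP; left; apply/existsP; exists x. Qed.

Lemma adjP u v :
  adj u v -> (exists x, v = rcons u x) \/ (exists x, u = rcons v x).
Proof. by case/orP=> /existsP[x /eqP ->]; [left|right]; exists x. Qed.

Lemma aut_size g w : size (g w) = size w.
Proof.
have [n] := ubnP (size w); elim: n w => // n IH w.
case/lastP: w => [|u x]; first by rewrite aut_nil.
rewrite size_rcons ltnS => un.
have := adj_rcons u x; rewrite -(aut_adj g) => /adjP[[y ->]|[y gu]].
  by rewrite size_rcons IH.
have := IH u un; rewrite gu size_rcons.
case/lastP: u => [//|u' z] in un gu * => _.
have := adj_rcons u' z; rewrite -(aut_adj g) => /adjP[[t]|[t gu']].
  rewrite gu => /rcons_inj[E _].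
  have := congr1 size (can_inj (autKV g) E); rewrite !size_rcons => /eqP.
  by rewrite gtn_eqF// ltnS leqnSn.
have := congr1 size gu'; rewrite size_rcons IH; last first.
  by rewrite (leq_trans _ un)// size_rcons ltnS leqnSn.
by rewrite IH// size_rcons => /eqP; rewrite ltn_eqF// leqnSn.
Qed.

Lemma aut_rcons g u x : exists y, g (rcons u x) = rcons (g u) y.
Proof.
have := adj_rcons u x; rewrite -(aut_adj g) => /adjP[//|[y E]].
have := congr1 size E; rewrite size_rcons !aut_size size_rcons => /eqP.
by rewrite ltn_eqF// leqnSn.
Qed.

Lemma aut_cat g v w : g (v ++ w) = g v ++ drop (size v) (g (v ++ w)).
Proof.
elim/last_ind: w => [|w x IH].
  by rewrite cats0 drop_oversize ?cats0// aut_size.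
have [y E] := aut_rcons g (v ++ w) x.
rewrite -rcons_cat {}E {1}IH rcons_cat; congr cat.
by rewrite -!cats1 drop_cat aut_size size_cat; case: ltngtP (leq_addr (size w) (size v)) => // E _;
  rewrite -E subnn drop0 drop_oversize// aut_size size_cat -E.
Qed.

Definition section_fun g v w : word d := drop (size v) (g (v ++ w)).

Lemma section_catE g v w : g (v ++ w) = g v ++ section_fun g v w.
Proof. exact: aut_cat. Qed.

Lemma section_funK g v :
  cancel (section_fun g v) (section_fun (g^-1)%g (g v)).
Proof.
move=> w; rewrite {1}/section_fun -section_catE autKV aut_size.
by rewrite drop_size_cat.
Qed.

Lemma section_fun_bij g v : bijective (section_fun g v).
Proof.
exists (section_fun (g^-1)%g (g v)); first exact: section_funK.
by have := section_funK (g^-1)%g (g v); rewrite invgK autKV.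
Qed.

Lemma adj_cat u v w : adj (u ++ v) (u ++ w) = adj v w.
Proof.
rewrite /adj; congr orb; apply: eq_existsb => x;
  by rewrite rcons_cat eqseq_cat// eqxx.
Qed.

Lemma section_is_aut g v : is_aut (Sym (section_fun_bij g v)).
Proof.
split=> [|u w] /=; first by rewrite /section_fun cats0 drop_oversize// aut_size.
by rewrite -(adj_cat (g v)) -!section_catE aut_adj adj_cat.
Qed.

Definition section g v : aut d := Aut (introT (asboolP _) (section_is_aut g v)).

Definition level_one_fun g x : 'I_d := head x (g [:: x]).

Lemma level_oneE g x : g [:: x] = [:: level_one_fun g x].
Proof.
by rewrite /level_one_fun; case: (g _) (aut_size g [:: x]) => [|y []].
Qed.

Lemma level_one_bij g : bijective (level_one_fun g).
Proof.
have K h : cancel (level_one_fun h) (level_one_fun (h^-1)%g).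
  move=> x; have := congr1 (h^-1)%g (level_oneE h x).
  by rewrite autKV level_oneE => -[].
by exists (level_one_fun (g^-1)%g) => //; have := K (g^-1)%g; rewrite invgK.
Qed.

Definition psi g : wreath (aut d) d :=
  (fun x => section g [:: x], Sym (level_one_bij g)).

Lemma psiM g h : psi (g * h) = psi g * psi h.
Proof.
have level_oneM x : level_one_fun (g * h) x = level_one_fun g (level_one_fun h x).
  by have := level_oneE (g * h) x; rewrite /= {1}level_oneE level_oneE => -[].
apply: (congr2 pair); last exact: symE.
apply/funext => x; apply: autE => w.
change (drop 1 (g (h (x :: w))) =
  drop 1 (g ([:: level_one_fun h x] ++ drop 1 (h (x :: w))))).
by rewrite -(level_oneE h x) -(aut_cat h [:: x] w).
Qed.

Definition level_stab (n : nat) : set (aut d) :=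
  [set g | forall w, size w = n -> g w = w].

Lemma level_stab_le m n : m <= n -> level_stab n `<=` level_stab m.
Proof.
move=> mn g gn [|x w] wm; first exact: aut_nil.
have := gn ((x :: w) ++ nseq (n - m) x).
rewrite size_cat size_nseq wm subnKC// => /(_ erefl)/eqP.
by rewrite section_catE eqseq_cat ?aut_size// => /andP[/eqP].
Qed.

(* the topology of aut d whose neighbourhoods of 1 are generated by the level
   stabilizers *)
Definition aut_open : set_system (aut d) :=
  [set A | forall g, A g ->
     exists n, forall h, level_stab n (g^-1 * h) -> A h].

Lemma aut_openT : aut_open setT.
Proof. by move=> g _; exists 0. Qed.

Lemma aut_openI : setI_closed aut_open.
Proof.
move=> A B oA oB g [/oA[m mA] /oB[n nB]]; exists (maxn m n) => h gh.
split; [apply: mA|apply: nB]; apply: level_stab_le gh.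
  exact: leq_maxl.
exact: leq_maxr.
Qed.

Lemma aut_open_bigU (I : Type) (f : I -> set (aut d)) :
  (forall i, aut_open (f i)) -> aut_open (\bigcup_i f i).
Proof.
move=> fo g [i _ /fo[n nf]]; exists n => h /nf fh; by exists i.
Qed.

HB.instance Definition _ :=
  isOpenTopological.Build (aut d) aut_openT aut_openI aut_open_bigU.

End Aut.

Arguments psi {d} g.

Definition self_similar d (H : set (aut d)) : Prop :=
  forall g v, H g -> H (section g v).

(* K x ... x K, inside the base group of the wreath product *)
Definition base_power (G : groupType) (d : nat) (K : set G) :
    set (wreath G d) :=
  [set u | (forall x, K (u.1 x)) /\ u.2 = 1].
Arguments base_power {G} d K.

Arguments self_similar {d} H.

Definition regular_branch_over d (H K : set (aut d)) : Prop :=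
  finite_index_subgroup H K /\
  finite_index_subgroup (psi @` K) (base_power d K).

Definition regular_branch d (H : set (aut d)) : Prop :=
  [/\ subgroup H, self_similar H & exists K, regular_branch_over H K].

Definition congruence_subgroup d (H K : set (aut d)) : Prop :=
  finite_index_subgroup H K /\ exists n, H `&` level_stab n `<=` K.

Arguments regular_branch_over {d} H K.
Arguments regular_branch {d} H.
Arguments congruence_subgroup {d} H K.

Definition boundary (d : nat) : Type := nat -> 'I_d.

Definition bprefix d (xi : boundary d) (n : nat) : word d := mkseq xi n.

Definition bcat d (v : word d) (xi : boundary d) : boundary d :=
  fun n => if n < size v then nth (xi 0) v n else xi (n - size v).

(* the n-th letter of g xi is the last letter of the image under g of the prefix
   of length n.+1 of xi *)
Definition bact_fun d (g : aut d) (xi : boundary d) : boundary d :=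
  fun n => nth (xi 0) (g (bprefix xi n.+1)) n.

Lemma bprefix_act d (g : aut d) xi n :
  bprefix (bact_fun g xi) n = g (bprefix xi n).
Proof.
elim: n => [|n IH]; first by rewrite aut_nil.
rewrite /bprefix mkseqS -/(bprefix _ _) IH /bact_fun.
have [y E] := aut_rcons g (bprefix xi n) (xi n).
rewrite /bprefix mkseqS -/(bprefix _ _) E nth_rcons.
by rewrite aut_size size_mkseq ltnn eqxx.
Qed.

Lemma bact_funK d (g : aut d) : cancel (bact_fun g) (bact_fun (g^-1)%g).
Proof.
move=> xi; apply/funext => n.
by rewrite {1}/bact_fun bprefix_act autKV nth_mkseq.
Qed.

Lemma bact_bij d (g : aut d) : bijective (bact_fun g).
Proof.
exists (bact_fun (g^-1)%g); first exact: bact_funK.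
by have := bact_funK (g^-1)%g; rewrite invgK.
Qed.

Definition bact d (g : aut d) : sym (boundary d) := Sym (bact_bij g).
Arguments bact {d} g.

Definition degree d (T : {fset word d}) (v : word d) : nat :=
  #|` [fset w in T | adj v w]%fset |.

(* a subgraph containing the root is connected iff it is closed under taking
   parents *)
Definition complete_subtree d (T : {fset word d}) : Prop :=
  [/\ [::] \in T,
      forall v x, rcons v x \in T -> v \in T,
      degree T [::] = d &
      forall v, v \in T -> v != [::] -> degree T v != 1%N -> degree T v = d.+1].

Definition leaves d (T : {fset word d}) : set (word d) :=
  [set v | v \in T /\ degree T v = 1%N].

(* A forest isomorphism from the complement of T to that of T' is given by a
   bijection s between the leaves and, for every leaf v of T, an automorphism
   a v of the tree: it maps v w to s v (a v) (w). The almost automorphisms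
   below are the permutations of the boundary induced by the ones for which
   all a v are in G. *)
Definition AAut d (G : set (aut d)) : set (sym (boundary d)) :=
  [set f | exists (T T' : {fset word d}) (s : word d -> word d)
                  (a : word d -> aut d),
     [/\ complete_subtree T /\ complete_subtree T',
         set_bij (leaves T) (leaves T') s,
         forall v, leaves T v -> G (a v) &
         forall v xi, leaves T v -> f (bcat v xi) = bcat (s v) (bact (a v) xi)]].

Arguments AAut {d} G.

(* AAut G as a topological space. In a group topology for which the subgroup G
   (acting through bact) is open and has the topology induced from aut d, the
   sets g (G `&` level_stab n) form a basis of neighbourhoods of g; so this
   describes the only such topology. *)
Definition aaut d (G : set (aut d)) : Type := set_type (AAut G).
Arguments aaut {d} G.

Section AAutTopology.
Variables (d : nat) (G : set (aut d)).

HB.instance Definition _ := Choice.on (aaut G).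

Definition aaut_val (f : aaut G) : sym (boundary d) := \val f.

Definition aaut_open : set_system (aaut G) :=
  [set A | forall g, A g -> exists n, forall h,
     (bact @` (G `&` level_stab n)) ((aaut_val g)^-1 * aaut_val h) -> A h].

Lemma aaut_openT : aaut_open setT.
Proof. by move=> g _; exists 0. Qed.

Lemma aaut_openI : setI_closed aaut_open.
Proof.
move=> A B oA oB g [/oA[m mA] /oB[n nB]]; exists (maxn m n) => h [k [Gk kmn] E].
split; [apply: mA|apply: nB]; exists k => //; split => //.
  exact: level_stab_le (leq_maxl _ _) _ kmn.
exact: level_stab_le (leq_maxr _ _) _ kmn.
Qed.

Lemma aaut_open_bigU (I : Type) (f : I -> set (aaut G)) :
  (forall i, aaut_open (f i)) -> aaut_open (\bigcup_i f i).
Proof.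
move=> fo g [i _ /fo[n nf]]; exists n => h /nf fh; by exists i.
Qed.

HB.instance Definition _ :=
  isOpenTopological.Build (aaut G) aaut_openT aaut_openI aaut_open_bigU.

End AAutTopology.

(* S1 and S2 are groups through the injections i1 and i2 onto subgroups of G1
   and G2. *)
Definition topological_group_iso (G1 G2 : groupType) (S1 S2 : topologicalType)
    (i1 : S1 -> G1) (i2 : S2 -> G2) (phi : S1 -> S2) : Prop :=
  (forall s t, exists2 u,
     i1 u = i1 s * i1 t & i2 (phi u) = i2 (phi s) * i2 (phi t)) /\
  exists psi : S2 -> S1,
    [/\ cancel phi psi, cancel psi phi, continuous phi & continuous psi].

(* Main.v *)
(* Write G for the closure of H, A = AAut H, L = AAut G and U_n for the
   stabilizer of level n in G. Because H branches over a subgroup K containing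
   a level stabilizer of H, an automorphism that fixes a level and whose
   sections there are elements of G fixing a deep enough level is itself in G;
   likewise an element of G whose sections at some level are in H is in H.
   Hence A `&` G = H and A is dense in L, so that A / H = L / G and L acts on
   A / H; conjugates of G are open in L. Conjugating by elements of A that swap
   two cones of different sizes, one cuts G down to U_n, so that the topology of
   L is the one of pointwise convergence on A / H. Finally the image of L is
   closed: a limit of elements of A is, up to translation, a limit of elements
   of H, which exists in G. *)

Require Import Defs.
From mathcomp Require Import all_boot finmap all_classical topology.

Set Implicit Arguments.
Unset Strict Implicit.
Unset Printing Implicit Defensive.

Local Open Scope classical_set_scope.

(** * Pointwise convergence of permutations *)

Lemma nbhs_sym (T : Type) (s : sym T) (t : T) :
  nbhs s [set s' : sym T | s' t = s t].
Proof.
pose D := discrete_topology {classic T}.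
have /(_ s) /= c : continuous (@sym_ptws T : sym T -> {ptws {classic T} -> D}).
  exact: initial_continuous.
have /(_ (sym_ptws s)) p :=
  @proj_continuous {classic T} (fun=> D) (t : {classic T}).
have := continuous_comp c p => /(_ [set x | x = s t]).
by apply; exact: (@discrete_set1 D).
Qed.

(** The topology is initial for a map into a product of discrete spaces, so convergence is tested
    one coordinate at a time, where it is eventual equality. *)
Lemma cvg_sym (T : Type) (F : set_system (sym T)) (s : sym T) :
  Filter F -> (forall t, F [set s' : sym T | s' t = s t]) -> F --> s.
Proof.
move=> FF Fs.
pose D := discrete_topology {classic T}.
suff c : (@sym_ptws T @ F) --> (sym_ptws s : {ptws T -> D}).
  move=> A /= [_ [[B oB <-] Bs BA]].
  have /c FB : nbhs (sym_ptws s : {ptws T -> D}) B by exact: open_nbhs_nbhs.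
  change (F A); exact: (@filterS _ F FF ((@sym_ptws T) @^-1` B)).
have FF' : Filter (@sym_ptws T @ F) by exact: fmap_filter.
apply/(@cvg_sup _ _ _ _ (sym_ptws s) FF') => t A [_ [[B oB <-] /= Bs BA]].
change (F ((@sym_ptws T) @^-1` A)).
apply: (@filterS _ F FF _ _ _ (Fs t)) => s' /= s't; apply: BA => /=.
by rewrite /sym_ptws s't.
Qed.

(** * The boundary of the tree *)

Section Boundary.
Local Open Scope group_scope.

Variable d : nat.
Implicit Types (u v w : word d) (xi eta : boundary d) (g h : aut d).

Lemma size_bprefix xi n : size (bprefix xi n) = n.
Proof. exact: size_mkseq. Qed.

Lemma eq_bprefix xi eta : (forall n, bprefix xi n = bprefix eta n) -> xi = eta.
Proof.
move=> E; apply/funext => n; have := congr1 (fun s => nth (xi 0) s n) (E n.+1).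
by rewrite !nth_mkseq.
Qed.

Lemma bprefix_bcat v xi n : bprefix (bcat v xi) (size v + n) = v ++ bprefix xi n.
Proof.
apply: (@eq_from_nth _ (xi 0)) => [|i].
  by rewrite size_bprefix size_cat size_bprefix.
rewrite size_bprefix => ilt; rewrite nth_mkseq// nth_cat /bcat.
case: ltnP => // vi; rewrite nth_mkseq// ltn_subLR//.
Qed.

Lemma bcat_nil xi : bcat [::] xi = xi.
Proof. by apply/funext => n; rewrite /bcat /= subn0. Qed.

Lemma bcat_inj v : injective (bcat v).
Proof.
move=> xi eta E; apply: eq_bprefix => n.
have := congr1 (fun x => bprefix x (size v + n)) E; rewrite !bprefix_bcat.
by move/eqP; rewrite eqseq_cat// => /andP[_ /eqP].
Qed.

Lemma bcat_cat u v xi : bcat (u ++ v) xi = bcat u (bcat v xi).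
Proof.
apply/funext => n; rewrite /bcat size_cat nth_cat.
case: ltnP => [lt|le].
  case: ltnP => [ltu|leu]; first exact: set_nth_default.
  by rewrite ltn_subLR// lt; apply: set_nth_default; rewrite ltn_subLR.
rewrite ltnNge (leq_trans (leq_addr _ _) le) /= ltnNge leq_subRL ?le /=.
  by rewrite subnDA.
by rewrite (leq_trans (leq_addr _ _) le).
Qed.

Lemma bcat_bprefix xi n : bcat (bprefix xi n) (fun i => xi (n + i)) = xi.
Proof.
apply/funext => i; rewrite /bcat size_bprefix; case: ltnP => [lt|le].
  by rewrite nth_mkseq.
by rewrite subnKC.
Qed.

Lemma bcat_ex xi n : exists2 v, size v = n & exists eta, xi = bcat v eta.
Proof.
exists (bprefix xi n); first exact: size_bprefix.
by exists (fun i => xi (n + i)); rewrite bcat_bprefix.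
Qed.

Lemma bprefix_bcat_le v xi n : n <= size v -> bprefix (bcat v xi) n = take n v.
Proof.
move=> nv; have E := bprefix_bcat v xi 0.
rewrite addn0 cats0 in E; rewrite -{2}E.
apply: (@eq_from_nth _ (xi 0)) => [|i].
  by rewrite size_bprefix size_take size_bprefix; case: ltngtP nv.
rewrite size_bprefix => lt; rewrite nth_take// !nth_mkseq//.
exact: leq_trans lt nv.
Qed.

Lemma bcat_prefix u v xi eta : bcat u xi = bcat v eta -> size u <= size v ->
  exists w, v = u ++ w.
Proof.
move=> E uv; exists (drop (size u) v).
rewrite -{1}(cat_take_drop (size u) v) -(bprefix_bcat_le eta uv) -E.
by rewrite bprefix_bcat_le// take_size.
Qed.

Lemma bcat_inj_size u v xi eta : size u = size v -> bcat u xi = bcat v eta ->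
  u = v /\ xi = eta.
Proof.
move=> uv E; have [|w vw] := bcat_prefix E; first by rewrite uv.
have w0 : w = [::].
  by apply/nilP; have := uv; rewrite vw size_cat => /eqP;
     rewrite -{1}[size u]addn0 eqn_add2l eq_sym.
by move: vw E; rewrite w0 cats0 => -> /bcat_inj.
Qed.

Lemma bprefix_bact g xi n : bprefix (bact g xi) n = g (bprefix xi n).
Proof. exact: bprefix_act. Qed.

Lemma bact_bcat g v xi : bact g (bcat v xi) = bcat (g v) (bact (section g v) xi).
Proof.
apply: eq_bprefix => n.
(* Prefixes of length at least [size v] suffice, the shorter ones being truncations of them. *)
suff E m : bprefix (bact g (bcat v xi)) (size v + m) =
           bprefix (bcat (g v) (bact (section g v) xi)) (size v + m).
  have := congr1 (take n) (E n).
  by rewrite /bprefix /mkseq -!map_take !take_iota (minn_idPl (leq_addl _ _)).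
rewrite bprefix_bact bprefix_bcat -(aut_size g v) bprefix_bcat bprefix_bact.
exact: section_catE.
Qed.

Lemma bactM g h : bact (g * h) = bact g * bact h.
Proof.
apply: symE => xi; apply: eq_bprefix => n.
by rewrite [RHS](bprefix_bact g) !bprefix_bact.
Qed.

Lemma bact1 : bact (1 : aut d) = 1.
Proof. by apply: symE => xi; apply: eq_bprefix => n; rewrite bprefix_bact. Qed.

Lemma bactV g : bact g^-1 = (bact g)^-1.
Proof.
by apply: (mulgI (bact g)); rewrite -bactM !mulgV bact1.
Qed.

(** As soon as there is a letter, every word is a prefix of a boundary point, so the boundary action
    determines the action on vertices. *)
Lemma bact_inj : 0 < d -> injective (@bact d).
Proof.
move=> d_gt0 g h gh; apply: autE => w.
pose xi := bcat w (fun=> Ordinal d_gt0).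
have wE : w = bprefix xi (size w) by rewrite bprefix_bcat_le// take_size.
by rewrite wE -!bprefix_bact gh.
Qed.

Lemma section1 v : section 1 v = 1 :> aut d.
Proof. by apply: autE => w; rewrite /= /section_fun drop_size_cat. Qed.

Lemma sectionM g h v : section (g * h) v = section g (h v) * section h v.
Proof.
apply: autE => w.
have E : (g * h) v ++ section (g * h) v w =
    g (h v) ++ section g (h v) (section h v w).
  by rewrite -!section_catE.
by move/eqP: E; rewrite eqseq_cat// => /andP[_ /eqP].
Qed.

Lemma level_stab_fix g n w : level_stab n g -> size w <= n -> g w = w.
Proof. by move=> gn wn; exact: (level_stab_le wn gn). Qed.

End Boundary.

(** * Complete subtrees *)

Section Trees.
Variables (d : nat) (d_ge2 : 2 <= d).
Implicit Types (u v w : word d) (T : {fset word d}) (x y : 'I_d).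

Lemma degreeE T u (s : seq (word d)) : uniq s ->
  (forall w, (w \in s) = (w \in T) && adj u w) -> degree T u = size s.
Proof.
move=> us sE; rewrite /degree.
have -> : [fset w in T | adj u w]%fset = [fset w in s]%fset.
  by apply/fsetP => w; rewrite !inE /= sE.
by rewrite card_fseq undup_id.
Qed.

Lemma degree_nil T : degree T [::] = #|[pred x | [:: x] \in T]|.
Proof.
rewrite cardE -(size_map (fun x => [:: x])); apply: degreeE.
  by rewrite map_inj_uniq ?enum_uniq// => x y [].
move=> w; apply/mapP/andP => [[x]|[wT /adjP[[x wE]|[x]]]].
- by rewrite mem_enum inE => xT ->; split=> //; exact: (adj_rcons [::]).
- by exists x; rewrite // mem_enum inE; move: wT; rewrite wE.
- by move=> /(congr1 size); rewrite size_rcons.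
Qed.

Lemma degree_rcons T u y : degree T (rcons u y) =
  (u \in T) + #|[pred x | rcons (rcons u y) x \in T]|.
Proof.
set v := rcons u y; set P := [pred x | _].
pose s := [seq rcons v x | x <- enum P].
have us : uniq s by rewrite map_inj_uniq ?enum_uniq// => a b /rcons_inj[].
have sP w : w \in s -> exists2 x, w = rcons v x & P x.
  by move=> /mapP[x]; rewrite mem_enum; exists x.
rewrite cardE -(size_map (rcons v)) -/s.
have vu : adj v u by apply/orP; right; apply/existsP; exists y.
have vs x : adj v (rcons v x) by exact: adj_rcons.
have -> : (u \in T) + size s = size ((if u \in T then [:: u] else [::]) ++ s).
  by case: ifP.
apply: degreeE.
  case: (boolP (u \in T)) => // uT /=; rewrite us andbT.
  apply/negP => /sP[x /(congr1 size)/eqP].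
  by rewrite /v !size_rcons ltn_eqF// ltnW.
move=> w; rewrite mem_cat; apply/orP/andP => [[|/sP[x -> Px]]|[wT]].
- by case: ifP => // uT; rewrite inE => /eqP->.
- by split.
- move=> /adjP[[x wE]|[x /rcons_inj[uw _]]].
    right; rewrite wE; apply/mapP; exists x => //.
    by rewrite mem_enum inE /= -wE.
  by left; move: wT; rewrite -uw => ->; rewrite mem_head.
Qed.

(** A vertex that is not a leaf has maximal degree; discounting the parent, if any, leaves d
    children in [T], that is, all of them. *)
Lemma complete_children T u x : complete_subtree T -> u \in T ->
  degree T u != 1 -> rcons u x \in T.
Proof.
case=> T0 Tpar Tnil Tdeg uT u1.
have card_full (P : pred 'I_d) : #|P| = d -> P x.
  move=> Pd; have /subset_cardP/(_ (subset_predT _)) PT : #|P| = #|'I_d|.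
    by rewrite Pd card_ord.
  by have := PT x; rewrite !inE.
apply: (card_full [pred x | rcons u x \in T]).
case/lastP: u uT u1 => [|u y] uT u1; first by rewrite -degree_nil.
have := Tdeg _ uT _ u1; rewrite degree_rcons (Tpar _ _ uT) => H.
by apply/succn_inj/H; rewrite -size_eq0 size_rcons.
Qed.

Lemma complete_leaf_prefix T v : complete_subtree T ->
  v \in T \/ exists u w, leaves T u /\ v = u ++ w.
Proof.
move=> cT; elim/last_ind: v => [|v x [vT|[u [w [lu ->]]]]].
- by left; case: cT.
- have [v1|v1] := eqVneq (degree T v) 1; last by left; exact: complete_children.
  by right; exists v, [:: x]; rewrite cats1.
- by right; exists u, (rcons w x); rewrite rcons_cat.
Qed.

(** * Complete subtrees from partitions of the boundary into cones *)

Section PrefixTree.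
Variable S : seq (word d).
Hypotheses (S_cover : forall xi : boundary d,
    exists v eta, v \in S /\ xi = bcat v eta)
  (S_antichain : forall u v xi eta, u \in S -> v \in S ->
     bcat u xi = bcat v eta -> u = v)
  (S_nil : [::] \notin S).

Definition prefix_tree : {fset word d} :=
  [fset u in flatten
     [seq [seq take i v | i <- iota 0 (size v).+1] | v <- S]]%fset.

Lemma prefix_treeP u :
  reflect (exists w, u ++ w \in S) (u \in prefix_tree).
Proof.
rewrite in_fset; apply: (iffP flatten_mapP) => [[v vS /mapP[i _ ->]]|[w uS]].
  by exists (drop i v); rewrite cat_take_drop.
exists (u ++ w) => //; apply/mapP; exists (size u).
  by rewrite mem_iota add0n ltnS size_cat leq_addr.
by rewrite take_size_cat.
Qed.

Let xi0 : boundary d := fun=> Ordinal (ltnW d_ge2).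

(** Two nested words of [S] are equal, so nothing in the tree extends a word of [S]. Conversely, the
    word of [S] covering a point below [rcons u x] extends [rcons u x], unless it is a prefix of
    [u]; in that case it is nested with a word of [S] extending [u], which forces [u] into [S]. *)
Lemma prefix_tree_child u x : u \in prefix_tree ->
  (rcons u x \in prefix_tree) = (u \notin S).
Proof.
move=> /prefix_treeP[w' uw'S]; apply/idP/idP => [/prefix_treeP[w]|uS].
  apply: contraL => uS; apply/negP => uwS.
  have := @S_antichain u _ (bcat (x :: w) xi0) xi0 uS uwS.
  rewrite cat_rcons bcat_cat => /(_ erefl)/(congr1 size)/eqP.
  by rewrite size_cat -{1}[size u]addn0 eqn_add2l.
have [v [eta [vS E]]] := S_cover (bcat (rcons u x) xi0).
have [uv|vu] := leqP (size (rcons u x)) (size v).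
  by have [w vE] := bcat_prefix E uv; apply/prefix_treeP; exists w; rewrite -vE.
case/negP: uS; rewrite -cats1 bcat_cat in E.
have [|w uE] := bcat_prefix (esym E); first by rewrite size_rcons ltnS in vu.
have := @S_antichain _ _ (bcat (w ++ w') xi0) xi0 vS uw'S.
rewrite -bcat_cat catA -uE => /(_ erefl) vE.
suff w0 : w = [::] by rewrite uE w0 cats0.
have := congr1 size vE; rewrite uE -catA size_cat => /eqP.
by rewrite -{1}[size v]addn0 eqn_add2l eq_sym size_cat addn_eq0 => /andP[/nilP].
Qed.

Lemma prefix_tree_nil : [::] \in prefix_tree.
Proof.
have [v [_ [vS _]]] := S_cover xi0.
by apply/prefix_treeP; exists v.
Qed.

Lemma prefix_tree_parent u x : rcons u x \in prefix_tree -> u \in prefix_tree.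
Proof.
move=> /prefix_treeP[w]; rewrite cat_rcons => uS.
by apply/prefix_treeP; exists (x :: w).
Qed.

Lemma card_children u : u \in prefix_tree ->
  #|[pred x | rcons u x \in prefix_tree]| = if u \in S then 0 else d.
Proof.
move=> uT; case: ifP => uS.
  by apply: eq_card0 => x; rewrite inE /= prefix_tree_child// uS.
rewrite -[RHS]card_ord; apply: eq_card => x.
by rewrite inE /= prefix_tree_child// uS.
Qed.

Lemma degree_prefix_tree u : u \in prefix_tree ->
  degree prefix_tree u = if u \in S then 1 else if u == [::] then d else d.+1.
Proof.
case/lastP: u => [|u x] uT.
  by rewrite degree_nil; have /= -> := card_children uT; rewrite (negPf S_nil).
rewrite degree_rcons card_children// (prefix_tree_parent uT).
rewrite -size_eq0 size_rcons.
by case: ifP.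
Qed.

Lemma prefix_tree_complete : complete_subtree prefix_tree.
Proof.
split; first exact: prefix_tree_nil.
- exact: prefix_tree_parent.
- by rewrite degree_prefix_tree ?prefix_tree_nil// (negPf S_nil).
- move=> v vT v0; rewrite degree_prefix_tree// (negPf v0).
  by case: ifP.
Qed.

Lemma leaves_prefix_tree : leaves prefix_tree = [set` S].
Proof.
apply/seteqP; split=> v /=.
  move=> [vT]; rewrite degree_prefix_tree//; case: ifP => // _.
  (* Outside [S] the degrees are d and d + 1, both different from 1 as d >= 2. *)
  by case: ifP => _ E; have := d_ge2; move: E; case: (d) => [|[]].
move=> vS; have vT : v \in prefix_tree.
  by apply/prefix_treeP; exists [::]; rewrite cats0.
by split=> //; rewrite degree_prefix_tree// vS.
Qed.

End PrefixTree.
End Trees.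

Local Open Scope group_scope.

(** * Schlichting completions of dense subgroups *)

Section Subgroup.
Variables (E : groupType) (A : set E) (A_group : subgroup A).

Lemma subgroup1 : A 1.
Proof. by have [/set_mem] := A_group. Qed.

Lemma subgroup_div f g : A f -> A g -> A (f * g^-1).
Proof.
by move=> /mem_set Af /mem_set Ag; have [_ /(_ _ _ Af Ag)/set_mem] := A_group.
Qed.

Lemma subgroupV g : A g -> A g^-1.
Proof. by move/(subgroup_div subgroup1); rewrite mul1g. Qed.

Lemma subgroupM f g : A f -> A g -> A (f * g).
Proof. by move=> Af /subgroupV Ag; rewrite -[g]invgK; exact: subgroup_div. Qed.

End Subgroup.

Lemma subgroupP (E : groupType) (A : set E) :
  A 1 -> (forall f g, A f -> A g -> A (f * g)) -> (forall g, A g -> A g^-1) ->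
  subgroup A.
Proof.
move=> A1 AM AV; split=> [|f g /set_mem Af /set_mem Ag]; apply/mem_set => //.
by apply: AM => //; exact: AV.
Qed.

Lemma subgroupI (E : groupType) (A B : set E) :
  subgroup A -> subgroup B -> subgroup (A `&` B).
Proof.
move=> A_group B_group; apply: subgroupP => [|f g [? ?] [? ?]|g [? ?]].
- by split; exact: subgroup1.
- by split; exact: subgroupM.
- by split; exact: subgroupV.
Qed.

Lemma ltranslateP (E : groupType) (A : set E) (f g : E) :
  ltranslate f A g <-> A (f^-1 * g).
Proof.
split=> [[a Aa <-]|Ag]; first by rewrite mulKg.
by exists (f^-1 * g) => //; rewrite mulVKg.
Qed.

(* A is dense in the topological group L, U is a compact open subgroup of L with
   A `&` U = B, and the U_ n form a basis of neighbourhoods of 1 in U. The last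
   four hypotheses say that A is dense, that the conjugates of U by A form a
   subbasis of neighbourhoods of 1, that these conjugates are open, and that U
   is complete. *)
Section SchlichtingModel.
Variables (E : groupType) (A B L U : set E) (U_ : nat -> set E).
Hypotheses (A_group : subgroup A) (L_group : subgroup L) (U_group : subgroup U)
  (Un_group : forall n, subgroup (U_ n)).
Hypotheses (AL : A `<=` L) (UL : U `<=` L) (BE : B = A `&` U)
  (UnU : forall n, U_ n `<=` U)
  (Un_le : forall m n, m <= n -> U_ n `<=` U_ m)
  (Un_sep : forall g, (forall n, U_ n g) -> g = 1).
Hypothesis A_dense : forall f n, L f -> exists2 g, A g & U_ n (g^-1 * f).
Hypothesis U_conj_basis : forall n, exists2 l : seq E, {in l, forall c, A c} &
  forall g, U g -> {in l, forall c, U (c^-1 * g * c)} -> U_ n g.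
Hypothesis U_conj_open : forall c, A c ->
  exists n, forall g, U_ n g -> U (c^-1 * g * c).
Hypothesis U_complete : forall h : nat -> E, (forall n, B (h n)) ->
  (forall m n, m <= n -> U_ m ((h m)^-1 * h n)) ->
  exists2 g, U g & forall n, U_ n ((h n)^-1 * g).

Notation cosets := (coset A B).
Implicit Types (C D : cosets) (s t : sym cosets) (f g c : E).

Let B_group : subgroup B.
Proof. by rewrite BE; exact: subgroupI. Qed.

Let BA : B `<=` A. Proof. by rewrite BE; exact: subIsetl. Qed.
Let BU : B `<=` U. Proof. by rewrite BE; exact: subIsetr. Qed.

Lemma coset_repr C : exists2 c, A c & \val C = ltranslate c B.
Proof. by case: C => /= X /set_mem[c Ac <-]; exists c. Qed.

Lemma coset_ex C : exists c, \val C c.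
Proof.
have [c _ ->] := coset_repr C; exists c.
by apply/ltranslateP; rewrite mulVg; exact: subgroup1.
Qed.

Lemma coset_sub C c : \val C c -> A c.
Proof.
have [g Ag ->] := coset_repr C => -[b /BA Ab <-].
exact: subgroupM.
Qed.

Lemma cosetE C c g : \val C c -> \val C g <-> B (c^-1 * g).
Proof.
have [c' Ac' ->] := coset_repr C => /ltranslateP Bc.
have cg : c^-1 * g = (c'^-1 * c)^-1 * (c'^-1 * g).
  by rewrite invgM invgK -mulgA mulVKg.
split=> [/ltranslateP Bg|Bg].
  by rewrite cg; apply: subgroupM => //; exact: subgroupV.
by apply/ltranslateP; rewrite -[_ * g](mulVKg (c'^-1 * c)) -cg; exact: subgroupM.
Qed.

Lemma coset_of_ex c : A c -> exists C, \val C c.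
Proof.
move=> Ac; have Cc : ltranslate c B \in lcosets A B by apply/mem_set; exists c.
exists (SigSub Cc); apply/ltranslateP; rewrite mulVg; exact: subgroup1.
Qed.

Lemma coset_inj C D c : \val C c -> \val D c -> C = D.
Proof.
move=> Cc Dc; apply/val_inj/funext => g; apply/propext.
by rewrite (cosetE g Cc) (cosetE g Dc).
Qed.

(* s is the permutation of A / B corresponding to f under the bijection of
   A / B with L / U induced by the inclusion. *)
Definition acts_as s f := forall C c g, \val C c -> \val (s C) g ->
  U (g^-1 * f * c).

(** Representatives of a coset differ by an element of B, which lies in U; hence the condition in
    [acts_as] can be tested on a single pair. *)
Lemma acts_as_rep s f C c g :
  \val C c -> \val (s C) g -> U (g^-1 * f * c) ->
  forall c' g', \val C c' -> \val (s C) g' -> U (g'^-1 * f * c').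
Proof.
move=> Cc Dg Ufc c' g' /(cosetE _ Cc)/BU Uc' /(cosetE _ Dg)/BU Ug'.
rewrite [_ * _](_ : _ = (g^-1 * g')^-1 * (g^-1 * f * c) * (c^-1 * c')).
  by do 2?apply: subgroupM => //; exact: subgroupV.
by rewrite invgM invgK -!mulgA !mulVKg.
Qed.

(** This is injectivity of A / B -> L / U, which holds because B is the intersection of A and U. *)
Lemma acts_as_unique f C D D' c g g' : \val C c -> \val D g -> \val D' g' ->
  U (g^-1 * f * c) -> U (g'^-1 * f * c) -> D = D'.
Proof.
move=> Cc Dg D'g' Ug Ug'; apply: (@coset_inj _ _ g') => //.
apply/(cosetE _ Dg); rewrite BE; split.
  exact: (subgroupM A_group (subgroupV A_group (coset_sub Dg)) (coset_sub D'g')).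
rewrite (_ : _ * _ = (g^-1 * f * c) * (g'^-1 * f * c)^-1).
  exact: subgroup_div.
by rewrite !invgM invgK -!mulgA mulVKg mulVKg.
Qed.

Lemma acts_as_inj s t f : acts_as s f -> acts_as t f -> s = t.
Proof.
move=> sf tf; apply: symE => C; have [c Cc] := coset_ex C.
have [g sg] := coset_ex (s C); have [g' tg] := coset_ex (t C).
exact: acts_as_unique Cc sg tg (sf _ _ _ Cc sg) (tf _ _ _ Cc tg).
Qed.

Lemma acts_as_mul s t f g :
  acts_as s f -> acts_as t g -> acts_as (s * t) (f * g).
Proof.
move=> sf tg C c c' Cc stc'; have [k tk] := coset_ex (t C).
have := subgroupM U_group (sf _ _ _ tk stc') (tg _ _ _ Cc tk).
by rewrite -!mulgA mulVKg.
Qed.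

(** By density f c U contains an element of A for every c in A, so translation by f on L / U is
    transported to A / B; the transport of f^-1 is the inverse map. *)
Lemma acts_as_ex f : L f -> exists s, acts_as s f.
Proof.
have im g C : L g ->
    exists D, forall c k, \val C c -> \val D k -> U (k^-1 * g * c).
  move=> Lg; have [c Cc] := coset_ex C.
  have [|k Ak /UnU Uk] := @A_dense (g * c) 0.
    by apply: subgroupM => //; exact/AL/(coset_sub Cc).
  have [D Dk] := coset_of_ex Ak; exists D => c' k' Cc' Dk'.
  have -> : k'^-1 * g * c' =
      (k^-1 * k')^-1 * (k^-1 * (g * c)) * (c^-1 * c').
    by rewrite invgM invgK -!mulgA !mulVKg.
  have Uk' : U (k^-1 * k') by apply: BU; apply/(cosetE _ Dk).
  have Uc' : U (c^-1 * c') by apply: BU; apply/(cosetE _ Cc).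
  exact: subgroupM (subgroupM _ (subgroupV _ Uk') Uk) Uc'.
move=> Lf; have LVf := subgroupV L_group Lf.
pose T g (Lg : L g) C := projT1 (cid (im g C Lg)).
have TP g (Lg : L g) C c k : \val C c -> \val (T g Lg C) k -> U (k^-1 * g * c).
  by rewrite /T; case: cid => D /= ; exact.
have TK g (Lg : L g) (LVg : L g^-1) : cancel (T g Lg) (T g^-1 LVg).
  move=> C; have [c Cc] := coset_ex C; have [k Tk] := coset_ex (T g Lg C).
  have [c' Tc'] := coset_ex (T g^-1 LVg (T g Lg C)).
  apply: (acts_as_unique (f := g^-1) Tk Tc' Cc); first exact: TP Tk Tc'.
  by have := subgroupV U_group (TP _ Lg _ _ _ Cc Tk); rewrite !invgM invgK mulgA.
(* [T] depends on a membership proof, so replacing f^-1^-1 by f also calls for identifying two such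
   proofs. *)
have LVVf : L f^-1^-1 by rewrite invgK.
have TK' : cancel (T f^-1 LVf) (T f Lf).
  move=> C; have := TK f^-1 LVf LVVf C; move: LVVf; rewrite invgK => LVVf.
  by rewrite (Prop_irrelevance LVVf Lf).
by exists (Sym (Bijective (TK f Lf LVf) TK')); exact: TP.
Qed.

(** For g in A the element k^-1 g c is in A, so it is in U exactly when it is in B. *)
Lemma acts_as_coset_action s g : A g -> acts_as s g <-> coset_action A B g s.
Proof.
move=> Ag; split=> [sg C|sg C c c' Cc].
  have [c Cc] := coset_ex C; have [k sk] := coset_ex (s C).
  apply/funext => c'; apply/propext; rewrite (cosetE _ sk).
  have Bk : B (k^-1 * (g * c)).
    rewrite BE; split; last by rewrite mulgA; exact: sg Cc sk.
    exact: (subgroupM A_group (subgroupV A_group (coset_sub sk))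
              (subgroupM A_group Ag (coset_sub Cc))).
  rewrite ltranslateP (cosetE _ Cc).
  have -> : k^-1 * c' = (k^-1 * (g * c)) * (c^-1 * (g^-1 * c')).
    by rewrite -!mulgA mulVKg mulVKg.
  split=> Bc; last exact: subgroupM.
  rewrite -[_ * (_ * c')](mulKg (k^-1 * (g * c))).
  by apply: subgroupM => //; exact: subgroupV.
rewrite sg => -[c2 /(cosetE _ Cc)/BU Uc2 <-].
rewrite (_ : _ * _ = (c^-1 * c2)^-1); first exact: subgroupV.
by rewrite !invgM invgK -!mulgA mulKg.
Qed.

(** The stabilizer of the coset of c is the conjugate c U c^-1. This translates between pointwise
    convergence on A / B and conjugates of U. *)
Lemma acts_as_agree s t f g C c : acts_as s f -> acts_as t g ->
  \val C c -> s C = t C <-> U (c^-1 * (f^-1 * g) * c).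
Proof.
move=> sf tg Cc; have [k sk] := coset_ex (s C).
have Us := sf _ _ _ Cc sk; split=> [st|Uc].
  have := tg _ _ _ Cc; rewrite -st => /(_ _ sk) Ut.
  have := subgroupM U_group (subgroupV U_group Us) Ut.
  by rewrite !invgM invgK -!mulgA mulVKg.
have [k' tk'] := coset_ex (t C); have Ut := tg _ _ _ Cc tk'.
apply: (acts_as_unique (f := g) Cc sk tk') => //.
rewrite (_ : _ * _ = (k^-1 * f * c) * (c^-1 * (f^-1 * g) * c)).
  exact: subgroupM.
by rewrite -!mulgA mulVKg mulVKg.
Qed.

(** An element acting trivially lies in every conjugate of U by A, hence in every [U_ n], hence is
    1. *)
Lemma acts_as_inj_r s f g : acts_as s f -> acts_as s g -> f = g.
Proof.
move=> sf sg; apply/(mulgI f^-1); rewrite mulVg; apply/esym/Un_sep => n.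
have Uc c : A c -> U (c^-1 * (f^-1 * g) * c).
  by move=> /coset_of_ex[C Cc]; apply/(acts_as_agree sf sg Cc).
have [l Al] := U_conj_basis n; apply.
  by have := Uc 1 (subgroup1 A_group); rewrite invg1 mul1g mulg1.
by move=> c /Al; exact: Uc.
Qed.

Lemma nbhs_agree s (l : seq E) :
  nbhs s [set t : sym cosets | {in l, forall c C, \val C c -> t C = s C}].
Proof.
elim: l => [|c l IH]; first exact: filterE.
have Hc : nbhs s [set t : sym cosets | forall C, \val C c -> t C = s C].
  (* If [c] represents no coset, the condition at [c] is empty. *)
  have [[C Cc]|nC] := pselect (exists C, \val C c).
    apply: filterS (nbhs_sym s C) => t tC D Dc.
    by rewrite (coset_inj Dc Cc).
  by apply: filterE => t C Cc; case: nC; exists C.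
apply: filterS (filterI Hc IH) => t [tc tl] c'; rewrite inE => /predU1P[->//|].
exact: tl.
Qed.

(** Finitely many conjugates of U intersect inside [U_ n], so agreement at finitely many cosets
    bounds f^-1 g. This gives continuity from permutations to L. *)
Lemma nbhs_acts_as s n : exists2 V, nbhs s V &
  forall t t' f g, V t -> V t' -> acts_as t f -> acts_as t' g -> U_ n (f^-1 * g).
Proof.
have [l Al Ul] := U_conj_basis n.
(* The extra 1 accounts for membership in U itself, which [U_conj_basis] also asks for. *)
eexists; first exact: nbhs_agree s (1 :: l).
move=> t t' f g ts t's tf t'g.
have Uc c : c \in 1 :: l -> A c -> U (c^-1 * (f^-1 * g) * c).
  move=> lc /coset_of_ex[C Cc]; apply/(acts_as_agree tf t'g Cc).
  by rewrite (ts c lc C Cc) (t's c lc C Cc).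
apply: Ul => [|c lc]; last by apply: Uc (Al _ lc); rewrite inE lc orbT.
by have := Uc 1 (mem_head _ _) (subgroup1 A_group); rewrite invg1 mul1g mulg1.
Qed.

(** Coset stabilizers are conjugates of U, hence open; this gives continuity from L to
    permutations. *)
Lemma acts_as_stable s f C : acts_as s f ->
  exists n, forall g t, acts_as t g -> U_ n (f^-1 * g) -> t C = s C.
Proof.
move=> sf; have [c Cc] := coset_ex C.
have [n Un] := U_conj_open (coset_sub Cc); exists n => g t tg Ug.
by apply/esym/(acts_as_agree sf tg Cc); exact: Un.
Qed.

(** Approximations of [s] from A that agree with it at the coset of 1 all lie in one coset k B.
    Translated by k^-1 they form a Cauchy sequence in B, with a limit g in U, and k g acts as
    [s]. *)
Lemma schlichting_acts_as s : schlichting A B s -> exists2 f, L f & acts_as s f.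
Proof.
move=> cs; have near_s P : nbhs s P -> exists t g, [/\ A g, acts_as t g & P t].
  by move=> /cs[t [[g Ag /(acts_as_coset_action _ Ag) tg] Pt]]; exists t, g.
have [C1 C11] := coset_of_ex (subgroup1 A_group).
have [k sk] := coset_ex (s C1); have Ak := coset_sub sk.
pose V n := projT1 (cid2 (nbhs_acts_as s n)).
have VP n : nbhs s (V n) by rewrite /V; case: cid2.
have VU n t t' f g : V n t -> V n t' -> acts_as t f -> acts_as t' g ->
  U_ n (f^-1 * g) by rewrite /V; case: cid2 => /= W _; exact.
(* Nesting the neighbourhoods puts the n-th approximation in [V m] for all m <= n, as the Cauchy
   estimate [hU] requires. *)
pose W n := [set t : sym cosets | forall i, i <= n -> V i t].
have WP n : nbhs s (W n).
  elim: n => [|n IH].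
    by apply: filterS (VP 0) => t Vt i; rewrite leqn0 => /eqP->.
  apply: filterS (filterI (VP n.+1) IH) => t [Vt Wt] i.
  by rewrite leq_eqVlt => /predU1P[->//|]; exact: Wt.
have appr n : exists gt : E * sym cosets,
    [/\ B (k^-1 * gt.1), acts_as gt.2 gt.1 & W n gt.2].
  have [t [g [Ag tg [tC Wt]]]] := near_s _ (filterI (nbhs_sym s C1) (WP n)).
  exists (g, t); split=> //=.
  rewrite BE; split; first exact: subgroupM (subgroupV _ _) _.
  by have := tg C1 1 k C11; rewrite tC mulg1; exact.
have [ht /all_and3] := choice appr.
pose h n := (ht n).1; pose t n := (ht n).2.
rewrite -/(h _) -/(t _) => -[Bh th Wt].
have hU m n : m <= n -> U_ m ((k^-1 * h m)^-1 * (k^-1 * h n)).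
  move=> mn; rewrite invgM invgK -mulgA mulVKg.
  exact: VU (Wt m m (leqnn m)) (Wt n m mn) (th m) (th n).
have [g Ug Ung] := U_complete Bh hU.
have kg n : U_ n ((h n)^-1 * (k * g)).
  by have := Ung n; rewrite invgM invgK -mulgA.
have Lkg : L (k * g) by apply: subgroupM => //; [exact: AL|exact: UL].
exists (k * g) => // C.
have [c Cc] := coset_ex C; have [k' sk'] := coset_ex (s C).
apply: (acts_as_rep Cc sk').
have [n Un] := U_conj_open (coset_sub Cc).
(* A further approximation g', chosen to agree with [s] at C, is compared with k g through h n: the
   permutations of g' and h n are both in [V n]. *)
have [t' [g' [Ag' tg' [tC' Wt']]]] := near_s _ (filterI (nbhs_sym s C) (VP n)).
have := tg' C c k' Cc; rewrite tC' => /(_ sk') Uk'.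
have Ung' : U_ n (g'^-1 * (k * g)).
  have := VU n _ _ _ _ Wt' (Wt n n (leqnn n)) tg' (th n).
  move=> /(subgroupM (Un_group n))/(_ (kg n)).
  by rewrite -!mulgA mulVKg.
rewrite (_ : _ * _ = (k'^-1 * g' * c) * (c^-1 * (g'^-1 * (k * g)) * c)).
  by apply: subgroupM => //; exact: Un.
by rewrite -!mulgA !mulVKg.
Qed.

Lemma acts_as_schlichting s f : L f -> acts_as s f -> schlichting A B s.
Proof.
move=> Lf sf.
(* [F] is the trace on A of the neighbourhood filter of f, carried over to permutations. It
   converges pointwise to [s], and by density each of its members meets the image of A. *)
pose F : set_system (sym cosets) := [set P | exists n, forall g t,
  A g -> acts_as t g -> U_ n (g^-1 * f) -> P t].
have FF : Filter F.
  split=> [|P Q [m mP] [n nQ]|P Q PQ [n nP]]; first by exists 0.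
    exists (maxn m n) => g t Ag tg Ug; split.
      by apply: mP Ag tg _; apply: Un_le Ug; exact: leq_maxl.
    by apply: nQ Ag tg _; apply: Un_le Ug; exact: leq_maxr.
  by exists n => g t Ag tg Ug; apply: PQ; exact: nP Ag tg Ug.
move=> P /(@cvg_sym _ F s FF)[C|n nP].
  have [n sC] := acts_as_stable C sf; exists n => g t Ag tg Ug.
  apply: sC tg _; rewrite -[_ * _]invgK; apply: subgroupV => //.
  by rewrite invgM invgK.
have [g Ag Ug] := A_dense n Lf; have [t tg] := acts_as_ex (AL Ag).
exists t; split; last exact: nP Ag tg Ug.
by exists g => //; exact/acts_as_coset_action.
Qed.

End SchlichtingModel.

(** * Almost automorphisms *)

Lemma bact_group d (A : set (aut d)) : subgroup A -> subgroup (bact @` A).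
Proof.
move=> A_group; apply: subgroupP => [|_ _ [f Af <-] [g Ag <-]|_ [g Ag <-]].
- by exists 1; [exact: (subgroup1 A_group)|exact: bact1].
- by exists (f * g); [exact: (subgroupM A_group)|exact: bactM].
- by exists g^-1; [exact: (subgroupV A_group)|exact: bactV].
Qed.

Section LocalForm.
Variables (d : nat) (d_ge2 : 2 <= d) (G : set (aut d)).
Hypotheses (G_group : subgroup G) (G_ss : self_similar G).
Implicit Types (u v w : word d) (xi eta : boundary d) (f g : sym (boundary d)).

(* Membership in AAut G with T the ball of radius n and no condition on T':
   since f is a bijection of the boundary, the cones of the images u partition
   it, so these vertices are the leaves of a complete subtree. *)
Definition locally_in n f := forall v, size v = n ->
  exists u a, G a /\ forall xi, f (bcat v xi) = bcat u (bact a xi).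

Lemma locally_in_choice n f : locally_in n f ->
  exists t : word d -> word d * aut d, forall v, size v = n ->
    G (t v).2 /\ forall xi, f (bcat v xi) = bcat (t v).1 (bact (t v).2 xi).
Proof.
move=> fn; suff /choice[t tP] v : exists t : word d * aut d, size v = n ->
    G t.2 /\ forall xi, f (bcat v xi) = bcat t.1 (bact t.2 xi) by exists t.
have [vn|/eqP vn] := eqVneq (size v) n; last by exists ([::], 1) => /vn.
by have [u [a ?]] := fn v vn; exists (u, a).
Qed.

Lemma locally_in_le m n f : m <= n -> locally_in m f -> locally_in n f.
Proof.
move=> mn fm v vn; have [|u [a [Ga fE]]] := fm (take m v).
  by rewrite size_takel ?vn.
exists (u ++ a (drop m v)), (section a (drop m v)); split; first exact: G_ss.
move=> xi; rewrite -{1}(cat_take_drop m v) bcat_cat fE bact_bcat.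
by rewrite -bcat_cat.
Qed.

Definition words n : seq (word d) := [seq val t | t <- enum {: n.-tuple 'I_d}].

Lemma mem_words n v : (v \in words n) = (size v == n).
Proof.
apply/mapP/eqP => [[t _ ->]|vn]; first exact: size_tuple.
by exists (tcast vn (in_tuple v)); rewrite ?mem_enum// -[RHS]/(tval _) val_tcast.
Qed.

Lemma other_letter (x : 'I_d) : exists y, y != x.
Proof.
have [x0|x0] := eqVneq x (Ordinal (ltnW d_ge2)); last first.
  by exists (Ordinal (ltnW d_ge2)); rewrite eq_sym.
by exists (Ordinal d_ge2); rewrite x0.
Qed.

Lemma other_word v : 0 < size v -> exists2 w, size w = size v & w != v.
Proof.
case: v => // x v _; have [y yx] := other_letter x.
by exists (y :: v) => //; apply: contra yx => /eqP[->].
Qed.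

Let xi0 : boundary d := fun=> Ordinal (ltnW d_ge2).

Lemma words_antichain n u v xi eta : u \in words n -> v \in words n ->
  bcat u xi = bcat v eta -> u = v.
Proof.
rewrite !mem_words => /eqP un /eqP vn; rewrite -vn in un.
by move=> /(bcat_inj_size un)[].
Qed.

Lemma words_cover n xi : exists v eta, v \in words n /\ xi = bcat v eta.
Proof.
by have [v vn [eta ->]] := bcat_ex xi n; exists v, eta; rewrite mem_words vn.
Qed.

Lemma AAut_locally_in f : AAut G f -> exists n, locally_in n f.
Proof.
case=> T [T' [s [a [[cT _] _ Ga fE]]]].
(* One level below the deepest vertex of [T] every word is outside [T], hence under a leaf. *)
exists (\max_(w <- enum_fset T) size w).+1 => v vn.
have [vT|[u [w [lu vE]]]] := complete_leaf_prefix v cT.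
  have : size v <= \max_(w <- enum_fset T) size w by exact: leq_bigmax_seq.
  by rewrite vn ltnn.
exists (s u ++ a u w), (section (a u) w); split; first exact/G_ss/Ga.
by move=> xi; rewrite vE bcat_cat fE// bact_bcat -bcat_cat.
Qed.

Lemma locally_in_AAut n f : locally_in n f -> AAut G f.
Proof.
(* Going one level down excludes level 0, where the ball is the root alone and not a complete
   subtree. *)
move=> /(locally_in_le (leqnSn n)); set N := n.+1.
move=> /locally_in_choice[sa saP].
pose s v := (sa v).1; pose a v := (sa v).2.
have Ga v : v \in words N -> G (a v) by rewrite mem_words => /eqP /saP[].
have fE v xi : v \in words N -> f (bcat v xi) = bcat (s v) (bact (a v) xi).
  by rewrite mem_words => /eqP /saP[_]; exact.
have fE' v xi : v \in words N -> f (bcat v (bact (a v)^-1 xi)) = bcat (s v) xi.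
  move=> vN; rewrite fE//.
  rewrite -[bact _ (bact _ _)]/((bact (a v) * bact (a v)^-1) xi).
  by rewrite -bactM mulgV bact1.
have s_anti u v xi eta : u \in words N -> v \in words N ->
    bcat (s u) xi = bcat (s v) eta -> u = v.
  move=> uN vN; rewrite -!fE'// => /(can_inj (symKV f)).
  exact: words_antichain uN vN.
pose S' := [seq s v | v <- words N].
have S'_anti u v xi eta :
    u \in S' -> v \in S' -> bcat u xi = bcat v eta -> u = v.
  by move=> /mapP[u' u'N ->] /mapP[v' v'N ->] /s_anti->.
have S'_cover xi : exists v eta, v \in S' /\ xi = bcat v eta.
  have [v [eta [vN E]]] := words_cover N (f^-1 xi).
  exists (s v), (bact (a v) eta); split; first exact: map_f.
  by rewrite -fE// -E symVK.
(* If [s v] were the root, its cone would contain the image of the cone of another word [v'],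
   against [s_anti]. *)
have S'_nil : [::] \notin S'.
  apply/mapP => -[v vN sv]; have [|v' v'v vv'] := @other_word v.
    by move: vN; rewrite mem_words => /eqP->.
  have v'N : v' \in words N by rewrite mem_words v'v -mem_words.
  case/eqP: vv'; apply: (s_anti _ _ xi0 (bcat (s v') xi0)) => //.
  by rewrite -sv bcat_nil.
have S_nil : [::] \notin words N by rewrite mem_words.
have [S_anti S_cover] := (@words_antichain N, @words_cover N).
exists (prefix_tree (words N)), (prefix_tree S'), s, a.
have lS := leaves_prefix_tree d_ge2 S_cover S_anti S_nil.
have lS' := leaves_prefix_tree d_ge2 S'_cover S'_anti S'_nil.
split.
- by split; exact: prefix_tree_complete.
- rewrite lS lS'; split=> [v /= vN|u v /set_mem/= uN /set_mem/= vN suv|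
    _ /= /mapP[v vN ->]].
  + exact: map_f.
  + by apply: (s_anti _ _ xi0 xi0) => //; rewrite suv.
  + by exists v.
- by rewrite lS => v; exact: Ga.
- by rewrite lS => v xi; exact: fE.
Qed.

Lemma locally_in_mul m n f g : locally_in n f -> locally_in m g ->
  exists k, locally_in k (f * g).
Proof.
(* The first m letters expose the local form of [g]; the other n give the image word [w] at least n
   letters, however short [u] is. *)
move=> fn gm; exists (m + n) => v vmn.
have [|u [b [Gb gE]]] := gm (take m v).
  by rewrite size_takel// vmn leq_addr.
pose w := u ++ b (drop m v).
have gE' xi : g (bcat v xi) = bcat w (bact (section b (drop m v)) xi).
  by rewrite -{1}(cat_take_drop m v) bcat_cat gE bact_bcat -bcat_cat.
have wn : n <= size w by rewrite size_cat aut_size size_drop vmn addKn leq_addl.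
have [|u' [a [Ga fE]]] := fn (take n w); first by rewrite size_takel.
exists (u' ++ a (drop n w)), (section a (drop n w) * section b (drop m v)).
split; first by apply: subgroupM => //; exact: G_ss.
move=> xi; rewrite -[LHS]/(f (g (bcat v xi))) gE' -{1}(cat_take_drop n w).
by rewrite bcat_cat fE bact_bcat -bcat_cat bactM.
Qed.

Lemma locally_in_inv n f : locally_in n f -> exists k, locally_in k f^-1.
Proof.
move=> /locally_in_choice[sa saP].
(* The image cones cover the boundary and none has a vertex longer than [w], so the one containing a
   point under [w] has a prefix of [w] as its vertex. *)
exists (\max_(v <- words n) size (sa v).1) => w wE.
have [v vn [eta fv]] := bcat_ex (f^-1 (bcat w xi0)) n.
have [Ga fE] := saP v vn.
have wE' : bcat w xi0 = bcat (sa v).1 (bact (sa v).2 eta).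
  by rewrite -fE -fv symVK.
have [|w' ww'] := bcat_prefix (esym wE').
  rewrite wE.
  apply: (@leq_bigmax_seq _ _ xpredT (fun v => size (sa v).1) v) => //.
  by rewrite mem_words vn.
pose a' := (sa v).2^-1; have Ga' : G a' by exact: subgroupV.
exists (v ++ a' w'), (section a' w'); split; first exact: G_ss.
move=> xi; rewrite bcat_cat -bact_bcat.
apply: (can_inj (symKV f)); rewrite symVK fE.
rewrite -[bact _ (bact _ _)]/((bact _ * bact a') _) -bactM mulgV bact1.
by rewrite ww' bcat_cat.
Qed.

Lemma AAut_group : subgroup (AAut G).
Proof.
apply: subgroupP => [|f g /AAut_locally_in[m fm] /AAut_locally_in[n gn]|
    f /AAut_locally_in[n fn]].
- apply: (@locally_in_AAut 0) => v _; exists v, 1; split; first exact: subgroup1.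
  by move=> xi; rewrite bact1.
- by have [k /locally_in_AAut] := locally_in_mul fm gn.
- by have [k /locally_in_AAut] := locally_in_inv fn.
Qed.

Lemma AAut_bact (g : aut d) : G g -> AAut G (bact g).
Proof.
move=> Gg; apply: (@locally_in_AAut 0) => v _; exists (g v), (section g v).
by split; [exact: G_ss|exact: bact_bcat].
Qed.

End LocalForm.

(** * Closures of branch groups *)

Section Closure.
Variable d : nat.
Implicit Types (v w : word d) (g h : aut d) (H : set (aut d)).

Lemma level_stab_group n : subgroup (@level_stab d n).
Proof.
apply: subgroupP => [w _ //|g h gn hn w wn|g gn w wn].
  by rewrite -[LHS]/(g (h w)) hn// gn.
by rewrite -{1}(gn w wn) autKV.
Qed.

Lemma level_stabP n g h :
  level_stab n (g^-1 * h) <-> forall w, size w = n -> h w = g w.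
Proof.
split=> gh w wn; last by rewrite -[LHS]/(g^-1 (h w)) gh// autKV.
by have := congr1 g (gh w wn); rewrite -[LHS]/(g (g^-1 (h w))) autVK.
Qed.

Lemma level_stab_eq n g h w :
  level_stab n (g^-1 * h) -> size w <= n -> h w = g w.
Proof.
move=> gh wn.
exact: (level_stabP (size w) g h).1 (level_stab_le wn gh) w erefl.
Qed.

Lemma level_stab_section m n g v :
  size v + m <= n -> level_stab n g -> level_stab m (section g v).
Proof.
move=> vmn gn w wm; have := level_stab_fix gn (w := v ++ w).
rewrite size_cat wm section_catE => /(_ vmn)/eqP.
by rewrite eqseq_cat ?aut_size// => /andP[_ /eqP].
Qed.

Lemma aut_closureP H g : closure H g <->
  forall n, exists2 h, H h & level_stab n (g^-1 * h).
Proof.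
split=> [clH n|clH P].
  have /clH[h [Hh gh]] : nbhs g [set h | level_stab n (g^-1 * h)].
    apply: open_nbhs_nbhs; split; last by rewrite /= mulVg => w.
    move=> k gk; exists n => h kh /=; rewrite -[h](mulVKg k) mulgA.
    exact: (subgroupM (level_stab_group n)).
  by exists h.
rewrite nbhsE => -[Q [oQ /oQ[n nQ]] QP].
by have [h Hh /nQ/QP Ph] := clH n; exists h.
Qed.

Lemma closure_group H : subgroup H -> subgroup (closure H).
Proof.
move=> H_group; apply: subgroupP => [|f g /aut_closureP cf /aut_closureP cg|
  g /aut_closureP cg].
- by apply: subset_closure; exact: subgroup1.
- apply/aut_closureP => n; have [f' Hf' ff'] := cf n; have [g' Hg' gg'] := cg n.
  exists (f' * g'); first exact: subgroupM.
  apply/level_stabP => w wn; rewrite -[LHS]/(f' (g' w)).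
  by rewrite (level_stab_eq gg') ?wn// (level_stab_eq ff') ?aut_size ?wn.
- apply/aut_closureP => n; have [g' Hg' gg'] := cg n.
  exists g'^-1; first exact: subgroupV.
  apply/level_stabP => w wn; apply: (can_inj (autKV g)).
  by rewrite autVK -(level_stab_eq gg') ?aut_size ?wn// autVK.
Qed.

Lemma closure_self_similar H : self_similar H -> self_similar (closure H).
Proof.
move=> ssH g v /aut_closureP cg; apply/aut_closureP => n.
have [h Hh gh] := cg (size v + n).
exists (section h v); first exact: ssH.
apply/level_stabP => w wn.
by rewrite /= /section_fun (level_stab_eq gh)// size_cat wn.
Qed.

(** The image of a word settles at the index equal to its length. The settled values preserve
    adjacency, as any two of them are values of a single [h m]. *)
Lemma aut_limit (h : nat -> aut d) :
  (forall m w, size w <= m -> h m w = h (size w) w) ->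
  exists g, forall n, level_stab n ((h n)^-1 * g).
Proof.
move=> hE; pose f w := h (size w) w; pose fV w := (h (size w))^-1 w.
have fK : cancel f fV by move=> w; rewrite /fV /f aut_size autKV.
have fVK : cancel fV f by move=> w; rewrite /fV /f aut_size autVK.
have f_aut : is_aut (Sym (Bijective fK fVK)).
  split=> [|u v] /=; first by rewrite /f aut_nil.
  rewrite /f -(hE (maxn (size u) (size v)) u) ?leq_maxl//.
  by rewrite -(hE (maxn (size u) (size v)) v) ?leq_maxr// aut_adj.
exists (Aut (introT (asboolP _) f_aut)) => n.
by apply/level_stabP => w <-.
Qed.

Lemma bact_section_eq g (a : aut d) v : (forall w, g (v ++ w) = v ++ a w) ->
  forall xi, bact g (bcat v xi) = bcat v (bact a xi).
Proof.
move=> gE xi; have gv : g v = v by have := gE [::]; rewrite aut_nil !cats0.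
rewrite bact_bcat gv; congr (bcat _ (bact _ _)); apply: autE => w.
by rewrite /= /section_fun gE drop_size_cat.
Qed.

End Closure.

(** * Branching and its consequences for the closure *)

Section Branch.
Variables (d : nat) (d_ge2 : 2 <= d) (H K : set (aut d)) (M : nat).
Hypotheses (H_group : subgroup H) (H_ss : self_similar H)
  (KH : K `<=` H) (HM : H `&` level_stab M `<=` K)
  (K_branch : base_power d K `<=` psi @` K).
Implicit Types (v w : word d) (g h : aut d).

(** The inclusion of K x ... x K in psi(K) is iterated: the elements obtained below each letter by
    induction are glued by an element of K trivial on level one. *)
Lemma branch_sections k (b : word d -> aut d) :
  (forall v, size v = k -> K (b v)) ->
  exists2 g, K g & forall v w, size v = k -> g (v ++ w) = v ++ b v w.
Proof.
elim: k b => [|k IH] b Kb.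
  by exists (b [::]) => [|[]//]; exact: Kb.
have /choice[c cP] x : exists g, K g /\
    forall v w, size v = k -> g (v ++ w) = v ++ b (x :: v) w.
  have [|g Kg gE] := IH (fun v => b (x :: v)); last by exists g.
  by move=> v vk; apply: Kb; rewrite /= vk.
have [|g Kg gE] := @K_branch (c, 1); first by split=> // x; case: (cP x).
exists g => // -[//|x v] w [vk]; have [_ /(_ v w vk) cE] := cP x.
have sg : section g [:: x] = c x.
  by have := congr1 (fun u : wreath (aut d) d => u.1 x) gE.
have gx : level_one_fun g x = x.
  by have := congr1 (fun u : wreath (aut d) d => u.2 x) gE.
rewrite -[(x :: v) ++ w]/([:: x] ++ (v ++ w)) section_catE level_oneE gx.
by rewrite -[section_fun g _]/(section g [:: x] : _ -> _) sg cE.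
Qed.

Notation G := (closure H).
Let G_group : subgroup G := closure_group H_group.
Let G_ss : self_similar G := closure_self_similar H_ss.
Let HG : H `<=` G := @subset_closure _ H.

(** As M <= m, good approximations of [a v] in H also fix level M and so lie in K. Gluing them gives
    a sequence in K that settles on every word, and its limit has the sections [a v]. *)
Lemma closure_branch_sections k m (a : word d -> aut d) : M <= m ->
  (forall v, size v = k -> G (a v) /\ level_stab m (a v)) ->
  exists g, [/\ G g, level_stab (k + m) g &
    forall v w, size v = k -> g (v ++ w) = v ++ a v w].
Proof.
move=> Mm aP.
have /choice[b bP] (nv : nat * word d) : exists b, size nv.2 = k ->
    K b /\ level_stab nv.1 ((a nv.2)^-1 * b).
  case: nv => n v /=; have [vk|vk] := eqVneq (size v) k; last first.
    by exists 1 => /eqP; rewrite (negPf vk).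
  (* Precision n serves the limit, precision M the membership in K. *)
  have [/aut_closureP Ga am] := aP v vk; have [h Hh ah] := Ga (maxn n M).
  exists h => _; split; last exact: level_stab_le (leq_maxl _ _) _ ah.
  apply: HM; split=> // w wM.
  by rewrite (level_stab_eq ah) ?wM ?leq_maxr// (level_stab_fix am)// wM.
have /choice[g /all_and2[Kg gE]] n : exists g, K g /\
    forall v w, size v = k -> g (v ++ w) = v ++ b (n, v) w.
  have [|g Kg gE] := @branch_sections k (fun v => b (n, v)); last by exists g.
  by move=> v vk; case: (bP (n, v) vk).
have gEa n v w : size v = k -> size w <= n -> g n (v ++ w) = v ++ a v w.
  by move=> vk wn; rewrite gE//; have [_ /level_stab_eq->] := bP (n, v) vk.
have gk n : level_stab k (g n).
  by move=> v vk; have := gEa n v [::] vk isT; rewrite aut_nil cats0.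
have [|l lP] := @aut_limit d g.
  move=> n w wn; have [wk|kw] := leqP (size w) k.
    by rewrite !(level_stab_fix (gk _)).
  have tk : size (take k w) = k by rewrite size_takel// ltnW.
  have sw : size (drop k w) <= size w by rewrite size_drop leq_subr.
  by rewrite -[w](cat_take_drop k) !gEa ?cat_take_drop// (leq_trans sw wn).
have lE v w : size v = k -> l (v ++ w) = v ++ a v w.
  move=> vk; rewrite (level_stab_eq (lP (size (v ++ w))))// gEa//.
  by rewrite size_cat leq_addl.
exists l; split=> //.
  apply/aut_closureP => n; exists (g n); first exact/KH.
  apply/level_stabP => w wn.
  by rewrite (level_stab_eq (lP n))// wn.
move=> w wkm; rewrite -[w](cat_take_drop k).
have tk : size (take k w) = k by rewrite size_takel// wkm leq_addr.
rewrite lE//; have [_ /level_stab_fix->//] := aP _ tk.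
by rewrite size_drop wkm addKn.
Qed.

Lemma closure_branch_bact k m (f : sym (boundary d)) (a : word d -> aut d) :
  M <= m -> (forall v, size v = k -> [/\ G (a v), level_stab m (a v) &
    forall xi, f (bcat v xi) = bcat v (bact (a v) xi)]) ->
  exists2 g, G g /\ level_stab (k + m) g & f = bact g.
Proof.
move=> Mm aP; have [|g [Gg gkm gE]] := @closure_branch_sections k m a Mm.
  by move=> v /aP[].
exists g => //; apply: symE => xi; have [v vk [eta ->]] := bcat_ex xi k.
have [_ _ ->] := aP v vk; apply/esym/bact_section_eq => w; exact: gE.
Qed.

Lemma cone_sub u v : (forall xi, exists eta, bcat u xi = bcat v eta) ->
  exists w, u = v ++ w.
Proof.
move=> uv; pose xi0 : boundary d := fun=> Ordinal (ltnW d_ge2).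
have [eta0 E0] := uv xi0.
have [vu|] := leqP (size v) (size u); first exact: bcat_prefix (esym E0) vu.
move=> lt; have [[|x w] vE] := bcat_prefix E0 (ltnW lt).
  by rewrite vE cats0 ltnn in lt.
(* Were [v] strictly below [u], a point under [u] leaving [v] at the letter x would escape the cone
   of [v]. *)
have [y /eqP[]] := other_letter d_ge2 x; have [eta] := uv (bcat [:: y] xi0).
rewrite vE bcat_cat => /bcat_inj /(congr1 (fun s => s 0)).
by [].
Qed.

(** The two maps have the cones of [u] and [v] as images, so these cones coincide; faithfulness on
    the boundary does the rest. *)
Lemma cone_inj u v (g h : aut d) :
  (forall xi, bcat u (bact g xi) = bcat v (bact h xi)) -> u = v /\ g = h.
Proof.
move=> E; have [|w vE] := @cone_sub u v.
  by move=> xi; exists (bact h ((bact g)^-1 xi)); rewrite -E symVK.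
have [|w' uE] := @cone_sub v u.
  by move=> xi; exists (bact g ((bact h)^-1 xi)); rewrite E symVK.
have w0 : w = [::].
  apply/nilP; have := congr1 size vE; rewrite uE -catA size_cat => /eqP.
  by rewrite -{1}[size u]addn0 eqn_add2l eq_sym size_cat addn_eq0 => /andP[].
rewrite w0 cats0 in vE; split=> //; apply: (bact_inj (ltnW d_ge2)).
by apply: symE => xi; apply: (@bcat_inj d v); rewrite -E vE.
Qed.

(* Close to g there is h in H; the sections of h^-1 g at level k are then in
   the level stabilizer of H contained in K, so that h^-1 g is in K. *)
Lemma AAut_closure_sub g : G g -> AAut H (bact g) -> H g.
Proof.
move=> Gg /(AAut_locally_in H_ss)[k gk].
have sH v : size v = k -> H (section g v).
  move=> /gk[u [a [Ha aE]]].
  have [|_ ->//] := @cone_inj (g v) u (section g v) a.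
  by move=> xi; rewrite -bact_bcat.
have [h Hh gh] := (aut_closureP H g).1 Gg (k + M).
have gh' : level_stab (k + M) (h^-1 * g).
  by apply/level_stabP => w wkM; rewrite (level_stab_eq gh)// wkM.
have [|c Kc cE] := @branch_sections k (section (h^-1 * g)).
  move=> v vk; apply: HM; split; last first.
    by apply: level_stab_section gh'; rewrite vk.
  rewrite sectionM; apply: subgroupM => //; last exact: sH.
  by apply: H_ss; exact: subgroupV.
suff -> : g = h * c by apply: subgroupM => //; exact: KH.
apply: (mulgI h^-1); rewrite mulKg; apply: (bact_inj (ltnW d_ge2)).
apply: symE => xi; have [v vk [eta ->]] := bcat_ex xi k.
rewrite (@bact_section_eq _ c (section (h^-1 * g) v)); last first.
  by move=> w; exact: cE.
by rewrite bact_bcat (level_stab_fix gh')// vk leq_addr.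
Qed.

(** On each cone of level k the local automorphism a of [f] is replaced by a close b in H. The
    correction has sections a^-1 b, which fix level [maxn n M], so branching provides it in G. *)
Lemma AAut_dense f n : AAut G f -> exists2 c, AAut H c &
  (bact @` (G `&` level_stab n)) (c^-1 * f).
Proof.
move=> /(AAut_locally_in G_ss)[k fk].
have /choice[t tP] v : exists t : word d * aut d * aut d, size v = k ->
    [/\ H t.2, level_stab (maxn n M) (t.1.2^-1 * t.2), G t.1.2 &
      forall xi, f (bcat v xi) = bcat t.1.1 (bact t.1.2 xi)].
  have [vk|vk] := eqVneq (size v) k; last first.
    by exists ([::], 1, 1) => /eqP; rewrite (negPf vk).
  have [u [a [Ga fE]]] := fk v vk.
  by have [b Hb ab] := (aut_closureP H a).1 Ga (maxn n M); exists (u, a, b).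
have [|g [Gg gkn gE]] := @closure_branch_sections k (maxn n M)
    (fun v => (t v).1.2^-1 * (t v).2) (leq_maxr _ _).
  move=> v /tP[Hb ab Ga _]; split=> //.
  exact: (subgroupM G_group (subgroupV G_group Ga) (HG Hb)).
exists (f * bact g).
  apply: (locally_in_AAut d_ge2 H_ss (n := k)) => v vk.
  have [Hb ab Ga fE] := tP v vk; exists (t v).1.1, (t v).2; split=> // xi.
  rewrite -[LHS]/(f (bact g (bcat v xi))).
  rewrite (@bact_section_eq _ _ ((t v).1.2^-1 * (t v).2)); last first.
    by move=> w; exact: gE.
  rewrite fE bactM -[bact _ _]/((bact (t v).1.2 * _) xi) mulgA.
  by rewrite -bactM mulgV bact1 mul1g.
exists g^-1; last by rewrite bactV invgM -mulgA mulVg mulg1.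
split; first exact: (subgroupV G_group).
apply: (subgroupV (@level_stab_group d n)); apply: level_stab_le gkn.
by rewrite (leq_trans (leq_maxl n M))// leq_addl.
Qed.

(** [c] maps the cones of level k to cones of bounded depth. An element of G fixing M further levels
    has a conjugate that preserves each cone of level k and acts there by an element of G fixing
    level M; branching puts it in G. *)
Lemma AAut_conj_open c : AAut G c -> exists n, forall g : sym (boundary d),
  (bact @` (G `&` level_stab n)) g -> (bact @` G) (c^-1 * g * c).
Proof.
move=> /(AAut_locally_in G_ss)[k /locally_in_choice[t tP]].
exists (\max_(v <- words d k) size (t v).1 + M) => _ [g [Gg gn] <-].
have [|g' [Gg' _] ->] := @closure_branch_bact k M (c^-1 * bact g * c)
    (fun v => (t v).2^-1 * section g (t v).1 * (t v).2) (leqnn M);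
  last by exists g'.
move=> v vk; have [Ga cE] := tP v vk.
have un : size (t v).1 + M <= \max_(v <- words d k) size (t v).1 + M.
  rewrite leq_add2r.
  apply: (@leq_bigmax_seq _ _ xpredT (fun v => size (t v).1) v) => //.
  by rewrite mem_words vk.
split.
- apply: (subgroupM G_group) => //; apply: (subgroupM G_group); last exact: G_ss.
  exact: (subgroupV G_group).
- move=> w wM; rewrite -[LHS]/((t v).2^-1 (section g (t v).1 ((t v).2 w))).
  by rewrite (level_stab_section un gn) ?aut_size// autKV.
- move=> xi; rewrite -[LHS]/(c^-1 (bact g (c (bcat v xi)))).
  apply: (can_inj (symKV c)); rewrite symVK !cE bact_bcat.
  rewrite (level_stab_fix gn) ?(leq_trans (leq_addr _ _) un)//.
  congr bcat; rewrite -[RHS]/((bact (t v).2 * _) xi) -bactM -mulgA mulVKg.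
  by rewrite bactM.
Qed.

Lemma closure_complete (h : nat -> sym (boundary d)) :
  (forall n, (bact @` H) (h n)) ->
  (forall m n, m <= n -> (bact @` (G `&` level_stab m)) ((h m)^-1 * h n)) ->
  exists2 g, (bact @` G) g &
    forall n, (bact @` (G `&` level_stab n)) ((h n)^-1 * g).
Proof.
move=> /(_ _)/cid2-/all_sig2[k Hk kh] hm.
have km m n : m <= n -> level_stab m ((k m)^-1 * k n).
  move=> /hm[g [_ gm]]; rewrite -!kh -bactV -bactM.
  by move=> /(bact_inj (ltnW d_ge2)) <-.
have [|g gP] := @aut_limit d k.
  by move=> m w wm; exact: level_stab_eq (km _ _ wm) (leqnn _).
have Gg : G g.
  apply/aut_closureP => n; exists (k n) => //.
  by apply/level_stabP => w wn; rewrite (level_stab_eq (gP n))// wn.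
exists (bact g); first by exists g.
move=> n; exists ((k n)^-1 * g); last by rewrite bactM bactV kh.
split=> //; apply: (subgroupM G_group) => //; apply: (subgroupV G_group).
exact: HG.
Qed.

Lemma bact_level_sep f :
  (forall n, (bact @` (G `&` level_stab n)) f) -> f = 1.
Proof.
move=> fn; have [g _ gf] := fn 0; rewrite -gf -[RHS](bact1 d); congr bact.
apply: autE => w; have [g' [_ g'w]] := fn (size w).
by rewrite -gf => /(bact_inj (ltnW d_ge2)) <-; exact: g'w.
Qed.

End Branch.

(** * Conjugating by swaps of cones *)

Section Swap.
Variables (d : nat) (p q : word d).
Implicit Types (v w : word d) (xi eta : boundary d).
Hypothesis pq_disj : forall xi eta, bcat p xi <> bcat q eta.

Definition swap_fun xi : boundary d :=
  if bprefix xi (size p) == p then bcat q (fun i => xi (size p + i))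
  else if bprefix xi (size q) == q then bcat p (fun i => xi (size q + i))
  else xi.

Lemma bcat_bprefix_eq v xi : bprefix xi (size v) = v ->
  xi = bcat v (fun i => xi (size v + i)).
Proof. by move=> xv; rewrite -{1}(bcat_bprefix xi (size v)) xv. Qed.

Lemma bprefix_bcat_size v xi : bprefix (bcat v xi) (size v) = v.
Proof. by rewrite bprefix_bcat_le// take_size. Qed.

Lemma swap_funl xi : swap_fun (bcat p xi) = bcat q xi.
Proof.
rewrite /swap_fun bprefix_bcat_size eqxx; congr bcat.
by apply: (@bcat_inj d p); rewrite -bcat_bprefix_eq// bprefix_bcat_size.
Qed.

Lemma swap_funr xi : swap_fun (bcat q xi) = bcat p xi.
Proof.
rewrite /swap_fun bprefix_bcat_size eqxx; case: eqP => [/bcat_bprefix_eq E|_].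
  by case: (@pq_disj _ _ (esym E)).
congr bcat.
by apply: (@bcat_inj d q); rewrite -bcat_bprefix_eq// bprefix_bcat_size.
Qed.

Lemma swap_fun_id xi : bprefix xi (size p) != p -> bprefix xi (size q) != q ->
  swap_fun xi = xi.
Proof. by rewrite /swap_fun => /negPf-> /negPf->. Qed.

Lemma swap_funK : involutive swap_fun.
Proof.
move=> xi; have [/bcat_bprefix_eq->|xp] := eqVneq (bprefix xi (size p)) p.
  by rewrite swap_funl swap_funr.
have [/bcat_bprefix_eq->|xq] := eqVneq (bprefix xi (size q)) q.
  by rewrite swap_funr swap_funl.
by rewrite !swap_fun_id.
Qed.

Definition swap : sym (boundary d) := Sym (Bijective swap_funK swap_funK).

Lemma swapV : swap^-1 = swap.
Proof.
by apply: (mulgI swap); rewrite mulgV; apply: symE => xi; rewrite /= swap_funK.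
Qed.

(** Below the depths of [p] and [q] each cone is inside one of the two cones or outside both, and
    the swap only rewrites its prefix. *)
Lemma swap_locally_in (H : set (aut d)) :
  H 1 -> locally_in H (maxn (size p) (size q)) swap.
Proof.
move=> H1 v vn;
have pv : size p <= size v by rewrite vn leq_maxl.
have qv : size q <= size v by rewrite vn leq_maxr.
have cone u (uv : size u <= size v) : take (size u) v = u ->
    forall xi, bcat v xi = bcat u (bcat (drop (size u) v) xi).
  by move=> tu xi; rewrite -{1}(cat_take_drop (size u) v) tu bcat_cat.
have [/(cone _ pv) vp|vp] := eqVneq (take (size p) v) p.
  exists (q ++ drop (size p) v), 1; split=> // xi.
  by rewrite vp bact1 /= swap_funl bcat_cat.
have [/(cone _ qv) vq|vq] := eqVneq (take (size q) v) q.
  exists (p ++ drop (size q) v), 1; split=> // xi.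
  by rewrite vq bact1 /= swap_funr bcat_cat.
exists v, 1; split=> // xi.
by rewrite bact1 /= swap_fun_id// bprefix_bcat_le.
Qed.

End Swap.

Section ConjBasis.
Variables (d : nat) (d_ge2 : 2 <= d) (H : set (aut d)).
Hypotheses (H_group : subgroup H) (H_ss : self_similar H).
Implicit Types (u v w : word d) (xi eta : boundary d) (g h : aut d).

(* If g v <> v, the points g v ++ [:: y; z], y <> x, are fixed by the swap, and
   their preimages under g lie in the cone of v, which the swap maps to the cone
   of q. So h would map q to g v ++ [:: y; z] for two different z. *)
Lemma swap_conj_fix v (q : word d) (x : 'I_d)
    (vq : forall xi eta, bcat v xi <> bcat q eta) w g h :
  q = w ++ [:: x; x] -> size w = size v ->
  (swap vq)^-1 * bact g * swap vq = bact h -> g v = v.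
Proof.
move=> qE wv gh; apply/eqP/negP => /negP gv.
have [y yx] := other_letter d_ge2 x.
pose P z : boundary d := bcat (g v ++ [:: y; z]) (fun=> x).
have fixP z : swap_fun v q (P z) = P z.
  have sv : size v <= size (g v ++ [:: y; z]).
    by rewrite size_cat aut_size leq_addr.
  have sq : size q = size (g v ++ [:: y; z]).
    by rewrite qE !size_cat aut_size wv.
  apply: swap_fun_id.
    by rewrite /P (bprefix_bcat_le _ sv) take_size_cat// aut_size.
  rewrite sq bprefix_bcat_size qE eqseq_cat ?aut_size//.
  by rewrite eqseq_cons (negPf yx) andbF.
have hq z : h q = g v ++ [:: y; z].
  pose xi := bact (section g v)^-1 (bcat [:: y; z] (fun=> x)).
  have E : bact h (bcat q xi) = P z.
    rewrite -gh swapV -[LHS]/(swap_fun v q (bact g (swap_fun v q (bcat q xi)))).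
    rewrite swap_funr// bact_bcat /xi.
    rewrite -[bact _ (bact _ _)]/((bact _ * bact (section g v)^-1) _).
    by rewrite -bactM mulgV bact1 -bcat_cat fixP.
  rewrite -[q](bprefix_bcat_size q xi) -bprefix_bact E /P bprefix_bcat_le.
    by rewrite take_oversize// qE !size_cat aut_size wv.
  by rewrite qE !size_cat aut_size wv.
have := hq x; rewrite (hq y) => /eqP; rewrite eqseq_cat// => /andP[_ /eqP[yx']].
by rewrite yx' eqxx in yx.
Qed.

(** For each word v of length n + 1, a swap exchanges its cone with one two levels deeper under
    another word of that length; by [swap_conj_fix], a conjugate still in the closure forces g v =
    v. *)
Lemma AAut_conj_basis n : exists2 l : seq (sym (boundary d)),
  {in l, forall c, AAut H c} &
  forall g : sym (boundary d), (bact @` closure H) g ->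
    {in l, forall c, (bact @` closure H) (c^-1 * g * c)} ->
    (bact @` (closure H `&` level_stab n)) g.
Proof.
pose x : 'I_d := Ordinal (ltnW d_ge2).
(* Length n + 1 rather than n: the root has no other word of its length. *)
have /choice[c cP] v : exists c : sym (boundary d), size v = n.+1 ->
    AAut H c /\ forall g h, c^-1 * bact g * c = bact h -> g v = v.
  have [vn|vn] := eqVneq (size v) n.+1; last first.
    by exists 1 => /eqP; rewrite (negPf vn).
  have [|w wv wNv] := @other_word d d_ge2 v; first by rewrite vn.
  have vq xi eta : bcat v xi <> bcat (w ++ [:: x; x]) eta.
    rewrite bcat_cat => /(bcat_inj_size (esym wv))[/esym/eqP].
    by rewrite (negPf wNv).
  exists (swap vq) => _; split.
    exact/(locally_in_AAut d_ge2 H_ss)/swap_locally_in/(subgroup1 H_group).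
  by move=> g h; exact: swap_conj_fix.
exists [seq c v | v <- words d n.+1].
  move=> _ /mapP[v vn ->]; apply: (cP v _).1.
  by move: vn; rewrite mem_words => /eqP.
move=> _ [g Gg <-] gl; exists g => //; split=> //.
apply: (level_stab_le (leqnSn n)) => v vn.
have [|h _ hE] := gl (c v); first by apply: map_f; rewrite mem_words vn.
by apply: (cP v vn).2 (esym hE).
Qed.

End ConjBasis.

(** * The isomorphism *)

Lemma AAut_mono d (A B : set (aut d)) : A `<=` B -> AAut A `<=` AAut B.
Proof.
move=> AB f [T [T' [s [a [cT sT Aa fE]]]]].
by exists T, T', s, a; split=> // v /Aa /AB.
Qed.

Lemma nbhs_aaut d (G : set (aut d)) (f : aaut G) n : subgroup G ->
  nbhs f [set g : aaut G |
    (bact @` (G `&` level_stab n)) ((aaut_val f)^-1 * aaut_val g)].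
Proof.
move=> G_group.
have Gn_group := bact_group (subgroupI G_group (@level_stab_group d n)).
apply: open_nbhs_nbhs; split; last by rewrite /= mulVg; exact: (subgroup1 Gn_group).
move=> g fg; exists n => h gh /=.
rewrite -[aaut_val h](mulVKg (aaut_val g)) mulgA.
exact: (subgroupM Gn_group).
Qed.

Theorem theorem7p10 (d : nat) (d_ge2 : 2 <= d) (H : set (aut d))
    (H_branch : regular_branch H)
    (H_congr : exists K : set (aut d),
       regular_branch_over H K /\ congruence_subgroup H K) :
  let G := closure H in
  let completion := schlichting (AAut H) (bact @` H) in
  exists phi : set_type completion -> aaut G,
    topological_group_iso (@set_val _ completion) (@aaut_val d G) phi /\
    forall g, AAut H g ->
      exists s : set_type completion,
        coset_action (AAut H) (bact @` H) g (set_val s) /\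
        aaut_val (phi s) = g.
Proof.
move=> G completion.
have [H_group H_ss _] := H_branch.
have [K [[[K_group KH _] [_ K_branch _]] [_ [M HM]]]] := H_congr.
have G_group : subgroup G by exact: closure_group.
have G_ss : self_similar G by exact: closure_self_similar.
have HG : H `<=` G by exact: subset_closure.
(* The abstract model is instantiated inside the symmetric group of the boundary. *)
pose U := bact @` G; pose U_ n := bact @` (G `&` level_stab n).
have A_group := AAut_group d_ge2 H_group H_ss.
have L_group := AAut_group d_ge2 G_group G_ss.
have U_group : subgroup U := bact_group G_group.
have Un_group n : subgroup (U_ n) :=
  bact_group (subgroupI G_group (@level_stab_group d n)).
have AL : AAut H `<=` AAut G := AAut_mono HG.
have UL : U `<=` AAut G by move=> _ [g Gg <-]; exact: AAut_bact.
have BE : bact @` H = AAut H `&` U.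
  apply/seteqP; split=> [_ [g Hg <-]|f [Ag [g Gg gf]]].
    by split; [exact: AAut_bact|exists g => //; exact: HG].
  exists g => //; rewrite -gf in Ag.
  exact: (AAut_closure_sub d_ge2 H_group H_ss KH HM K_branch Gg Ag).
have UnU n : U_ n `<=` U by move=> _ [g [Gg _] <-]; exists g.
have Un_le m n : m <= n -> U_ n `<=` U_ m.
  move=> mn _ [g [Gg gn] <-]; exists g => //; split=> //.
  exact: level_stab_le mn _ gn.
have Un_sep : forall g, (forall n, U_ n g) -> g = 1 := @bact_level_sep d d_ge2 H.
have dense := AAut_dense d_ge2 H_group H_ss KH HM K_branch.
have basis := AAut_conj_basis d_ge2 H_group H_ss.
have conj_open c : AAut H c -> exists n, forall g, U_ n g -> U (c^-1 * g * c).
  by move=> /AL; exact: (AAut_conj_open H_group H_ss KH HM K_branch).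
have complete := closure_complete d_ge2 H_group.
have /choice[phi phiP] (s : set_type completion) :
    exists f : aaut G, acts_as U (set_val s) (aaut_val f).
  have [f Lf sf] := schlichting_acts_as A_group L_group U_group Un_group AL UL
    BE basis conj_open complete (set_mem (valP s)).
  by exists (SigSub (mem_set Lf)).
have /choice[psi psiP] (f : aaut G) :
    exists s : set_type completion, acts_as U (set_val s) (aaut_val f).
  have Lf : AAut G (aaut_val f) := set_mem (valP f).
  have [s sf] := acts_as_ex A_group L_group U_group AL BE UnU dense Lf.
  have cs := acts_as_schlichting A_group L_group U_group Un_group AL BE UnU
    Un_le dense conj_open Lf sf.
  by exists (SigSub (mem_set cs)).
(* The relation [acts_as] is one-to-one both ways, which makes [phi] and [psi] mutually inverse. *)
have psi_unique (s : set_type completion) f :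
    acts_as U (set_val s) (aaut_val f) -> psi f = s.
  by move=> sf; apply/val_inj/(acts_as_inj A_group U_group BE (psiP f) sf).
have phi_unique (s : set_type completion) f :
    acts_as U (set_val s) (aaut_val f) -> phi s = f.
  move=> sf; apply/val_inj.
  exact: (acts_as_inj_r A_group U_group BE Un_sep basis (phiP s) sf).
exists phi; split; last first.
  move=> g Ag; pose f : aaut G := SigSub (mem_set (AL _ Ag)).
  exists (psi f); split; last by rewrite (phi_unique (psi f) f (psiP f)).
  exact/(acts_as_coset_action A_group U_group BE _ Ag)/psiP.
split.
  move=> s t; have Lst : AAut G (aaut_val (phi s) * aaut_val (phi t)).
    by apply: (subgroupM L_group); exact: set_mem (valP _).
  pose f : aaut G := SigSub (mem_set Lst).
  exists (psi f); last by rewrite (phi_unique (psi f) f (psiP f)).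
  apply: (acts_as_inj A_group U_group BE (psiP f)).
  exact: (acts_as_mul A_group U_group BE (phiP s) (phiP t)).
exists psi; split.
- by move=> s; exact/psi_unique/phiP.
- by move=> f; exact/phi_unique/psiP.
(* Finitely many values of the permutation confine the element of [AAut G] to a coset of [U_ n]. *)
- move=> s P; rewrite nbhsE => -[Q [oQ /oQ[n nQ]] QP].
  have [V sV VU] := nbhs_acts_as A_group U_group BE basis (set_val s) n.
  have sV' : nbhs s (set_val @^-1` V) by exact: (initial_continuous sV).
  apply: filterS sV' => t Vt; apply/QP/nQ.
  exact: VU (nbhs_singleton sV) Vt (phiP s) (phiP t).
(* Continuity into the completion is checked at one coset C at a time: elements close to f act on C
   as f does. *)
- apply: continuous_comp_initial => f.
  apply: cvg_sym => [|C]; first by apply: fmap_filter; exact: nbhs_filter.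
  have [n nC] := acts_as_stable A_group U_group BE conj_open C (psiP f).
  apply: filterS (nbhs_aaut f n G_group) => g fg.
  exact: nC (psiP g) fg.
Qed.
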